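(* Let $(\Sigma,y_\Sigma)$ be a scene, where $\Sigma=\partial\Omega\subset\mathbb{R}^3$ is a closed convex $C^1$ surface diffeomorphic to $\mathbb{S}^2$ and $y_\Sigma:\mathbb{S}^2\to\mathbb{R}$ is $C^1$. The scene $(\Sigma,y_\Sigma)$ admits a non-trivial stationary motion, i.e. a stationary motion $(\mathbf{p_v},\mathbf{p_\omega})\in\mathbb{R}^3\times\mathbb{R}^3$ with $(\mathbf{p_v},\mathbf{p_\omega})\neq(0,0)$, if and only if it admits a rotation axis.
   Context: Scene: $\Omega\subset\mathbb{R}^3$ is a bounded open convex domain whose boundary $\Sigma=\partial\Omega$ is a closed convex $C^1$ surface diffeomorphic to $\mathbb{S}^2$; points of $\Sigma$ are labelled by $s\in\mathbb{S}^2$ through a $C^1$ diffeomorphism $s\mapsto M(s)\in\Sigma$. The function $y_\Sigma:\mathbb{S}^2\to\mathbb{R}$ is $C^1$ and $y_\Sigma(s)$ is the light intensity emitted by $M(s)$. Fields seen by a camera: vectors of $\mathbb{R}^3$ are identified with imaginary quaternions. For a camera with optical center $C\in\Omega$ and orientation given by a unit quaternion $q$ (a vector $\varsigma$ in the camera frame is $q\varsigma q^*$ in the reference frame), each $\boldsymbol{\eta}\in\mathbb{S}^2$ corresponds to exactly one $s\in\mathbb{S}^2$ with $\boldsymbol{\eta}=q^*\frac{\overrightarrow{CM(s)}}{\|\overrightarrow{CM(s)}\|}q$. The brightness and depth fields are $y(\boldsymbol{\eta})=y_\Sigma(s)$ and $D(\boldsymbol{\eta})=\|\overrightarrow{CM(s)}\|$;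 they are $C^1$ on $\mathbb{S}^2$ and $D>0$. (In the camera frame, with origin at the camera, $\Sigma=\{D(\boldsymbol{\eta})\boldsymbol{\eta}:\boldsymbol{\eta}\in\mathbb{S}^2\}$.) Here $\nabla f$ is the gradient on the Riemannian unit sphere $\mathbb{S}^2\subset\mathbb{R}^3$, seen as a vector of $\mathbb{R}^3$ orthogonal to $\boldsymbol{\eta}$; $\cdot$ and $\times$ are the Euclidean scalar and vector products. Stationary motion: a constant pair $(\mathbf{p_v},\mathbf{p_\omega})\in\mathbb{R}^3\times\mathbb{R}^3$ (linear and angular velocities in the camera frame) is a stationary motion inside $(\Sigma,y_\Sigma)$ if for some camera pose $(C,q)$ with $C\in\Omega$ the associated brightness and depth fields $(y,D)$ satisfy, for all $\boldsymbol{\eta}\in\mathbb{S}^2$, $$\nabla D\cdot\Big(\boldsymbol{\eta}\times\big(\mathbf{p_\omega}+\tfrac1D\boldsymbol{\eta}\times\mathbf{p_v}\big)\Big)+\boldsymbol{\eta}\cdot\mathbf{p_v}=0,\qquad \nabla y\cdot\Big(\boldsymbol{\eta}\times\big(\mathbf{p_\omega}+\tfrac1D\boldsymbol{\eta}\times\mathbf{p_v}\big)\Big)=0.$$ The null motion $(0,0)$ is always stationary. Rotation axis: the scene admits a rotation axis if there is a line in $\mathbb{R}^3$ such that both the surface $\Sigma$ and the intensity (viewed as the function $M(s)\mapsto y_\Sigma(s)$ on $\Sigma$) are invariant under all rotations about this line. *)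

(* Defs.v *)
From mathcomp Require Export all_boot all_order all_algebra.
From mathcomp Require Export all_classical all_reals all_analysis.

Set Implicit Arguments.
Unset Strict Implicit.
Unset Printing Implicit Defensive.

Import Order.TTheory GRing.Theory Num.Theory.
Import numFieldNormedType.Exports.

Local Open Scope classical_set_scope.
Local Open Scope ring_scope.

Section Euclidean3.
Variable R : realType.
Implicit Types u v : 'rV[R]_3.

Definition dot u v : R := \sum_i u 0 i * v 0 i.

(* The library norm on 'rV[R]_3 is the sup norm: it is used below only for its
   topology, and metric notions use the Euclidean norm enorm. *)
Definition enorm u : R := Num.sqrt (dot u u).

Definition cross u v : 'rV[R]_3 :=
  \row_(j < 3) [:: u 0 1 * v 0 2%:R - u 0 2%:R * v 0 1;
                   u 0 2%:R * v 0 0 - u 0 0 * v 0 2%:R;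
                   u 0 0 * v 0 1 - u 0 1 * v 0 0]`_j.

Definition sphere2 : set 'rV[R]_3 := [set x | enorm x = 1].

(* Rotation of angle theta about the line a + R u, for a unit vector u
   (Rodrigues' formula). *)
Definition axis_rotation (a u : 'rV[R]_3) (theta : R) (x : 'rV[R]_3) :=
  let w := x - a in
  a + (cos theta *: w + sin theta *: cross u w
       + ((1 - cos theta) * dot u w) *: u).

End Euclidean3.

Arguments sphere2 : clear implicits.

Section Quaternions.
Variable R : realType.

(* A quaternion is a pair (scalar part, imaginary part). *)
Definition quat := (R * 'rV[R]_3)%type.

Definition imq (v : 'rV[R]_3) : quat := (0, v).

Definition qmul (p q : quat) : quat :=
  (p.1 * q.1 - dot p.2 q.2, p.1 *: q.2 + q.1 *: p.2 + cross p.2 q.2).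

Definition qconj (q : quat) : quat := (q.1, - q.2).

Definition unit_quat (q : quat) : Prop := q.1 ^+ 2 + dot q.2 q.2 = 1.

End Quaternions.

Section Calculus.
Variable R : realType.

Definition C1_open (V W : normedModType R) (U : set V) (F : V -> W) : Prop :=
  forall x, U x ->
    differentiable F x /\ forall v, {for x, continuous ('D_v F)}.

(* C^1 maps on an arbitrary subset A (here S^2 or the surface Sigma), in the
   usual sense of submanifolds: local restrictions of ambient C^1 maps.
   The values of f outside A are irrelevant. *)
Definition C1_on (V W : normedModType R) (A : set V) (f : V -> W) : Prop :=
  forall x, A x -> exists (U : set V) (F : V -> W),
    [/\ open U, U x, C1_open U F & {in A `&` U, f =1 F}].

Definition C1_diffeo (V W : normedModType R) (A : set V) (B : set W)
    (f : V -> W) : Prop :=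
  [/\ set_bij A B f, C1_on A f &
      exists g : W -> V, C1_on B g /\ {in A, cancel f g}].

(* g is the Riemannian gradient of f at eta on S^2: g is tangent at eta and
   df_eta(c'(0)) = (f \o c)'(0) = <g, c'(0)> for every curve c on S^2 through
   eta. *)
Definition is_sphere_grad (f : 'rV[R]_3 -> R) (eta g : 'rV[R]_3) : Prop :=
  dot g eta = 0 /\
  forall c : R -> 'rV[R]_3,
    (forall t, sphere2 R (c t)) -> c 0 = eta -> derivable c 0 1 ->
    is_derive (0 : R) (1 : R) (f \o c) (dot g ('D_1 c 0)).

Definition sphere_grad (f : 'rV[R]_3 -> R) (eta : 'rV[R]_3) : 'rV[R]_3 :=
  get [set g | is_sphere_grad f eta g].

End Calculus.

Section Scene.
Variable R : realType.
Implicit Types (Omega : set 'rV[R]_3) (M : 'rV[R]_3 -> 'rV[R]_3)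
  (ysigma : 'rV[R]_3 -> R) (C eta s : 'rV[R]_3) (q : quat R).

Definition boundary (A : set 'rV[R]_3) : set 'rV[R]_3 :=
  closure A `\` interior A.

(* M and ysigma are functions on S^2: only their values on sphere2 matter. *)
Record scene Omega M ysigma : Prop := Scene {
  scene_nonempty : Omega !=set0;
  scene_open : open Omega;
  scene_bounded : bounded_set Omega;
  scene_convex : convex_set Omega;
  scene_surface : C1_diffeo (sphere2 R) (boundary Omega) M;
  scene_light : C1_on (sphere2 R) ysigma }.

Definition view_quat M C q s : quat R :=
  qmul (qmul (qconj q) (imq ((enorm (M s - C))^-1 *: (M s - C)))) q.

(* The label s of the point seen in direction eta from the pose (C, q); for C
   in Omega and eta in S^2 it is unique. *)
Definition label_seen M C q eta : 'rV[R]_3 :=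
  get [set s | sphere2 R s /\ imq eta = view_quat M C q s].

Definition brightness M ysigma C q eta : R := ysigma (label_seen M C q eta).

Definition depth M C q eta : R := enorm (M (label_seen M C q eta) - C).

Definition stationary_motion Omega M ysigma (pv pw : 'rV[R]_3) : Prop :=
  exists C q, [/\ Omega C, unit_quat q &
    let y := brightness M ysigma C q in
    let D := depth M C q in
    forall eta, sphere2 R eta ->
      dot (sphere_grad D eta) (cross eta (pw + (D eta)^-1 *: cross eta pv))
        + dot eta pv = 0 /\
      dot (sphere_grad y eta) (cross eta (pw + (D eta)^-1 *: cross eta pv))
        = 0].

Definition has_rotation_axis Omega M ysigma : Prop :=
  exists a u : 'rV[R]_3, enorm u = 1 /\
    forall theta : R,
      axis_rotation a u theta @` boundary Omega = boundary Omega /\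
      forall s s', sphere2 R s -> sphere2 R s' ->
        M s' = axis_rotation a u theta (M s) -> ysigma s' = ysigma s.

End Scene.

(* Main.v *)
From HB Require Import structures.
Require Import Defs.
From mathcomp Require Import ring.

(** Seen from the optical center [C], the surface is the unit level set
    [p x = 1], with [x] counted from [C], of the Minkowski gauge [p] of
    [Omega] centered at [C], and the light intensity extends to a function [L]
    constant on the rays from [C].  The depth in the direction of [x] is the
    Euclidean norm of [x] divided by [p x].  Once the pose is undone, a motion
    becomes the velocity field [V x = P + cross W x] of a rigid
    body, and the two equations of a stationary motion say
    exactly that [dp_x (V x) = 0] and [dL_x (V x) = 0] at each surface point:
    the field is tangent to the surface and the intensity does not change along
    it (lemma [stationaryP]).

    Given a rotation axis, [p] and [L] are constant along the circles described
    by the surface points, so differentiating at angle 0 yields a stationary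
    motion with [W] the direction of the axis ([tangent_of_axis]).

    Conversely, the flow of [V] is an explicit screw motion.  By homogeneity
    [dp_x (V x) = (1 - p x) dp_x P] for all nonzero [x], and [dp P] is bounded;
    so [(p ^ 2 - 1) ^ 2] obeys a Gronwall inequality along the flow and vanishes
    identically on the orbit of a surface point ([flow_gauge]).  Orbits thus
    stay on the surface, and [L] is constant on them ([flow_light]).  As the
    surface is bounded, the screw has no translation part, hence it is a
    nontrivial rotation and its axis is an axis of the scene
    ([axis_of_tangent]).

    All this requires [p] and [L] to be differentiable.  Convexity gives a
    sublinear, hence Lipschitz, gauge.  The homogeneous extension [polar] of the
    parametrization [M] satisfies [p (polar y) = |y|], and its differential is
    injective because [M] has a differentiable inverse and [p] is Lipschitz
    ([polar_inj]).  A Lipschitz function which becomes differentiable after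
    composition with a map of invertible differential is differentiable
    ([differentiable_of_lift]). *)

Set Implicit Arguments.
Unset Strict Implicit.
Unset Printing Implicit Defensive.

Import Order.TTheory GRing.Theory Num.Theory.
Import numFieldNormedType.Exports.

Local Open Scope classical_set_scope.
Local Open Scope ring_scope.

(** * Vector algebra and quaternion rotations *)

Section VectorAlgebra.
Variable R : realType.
Implicit Types (a u v w x : 'rV[R]_3) (k t : R) (q : quat R).

Lemma ord3_ind (P : 'I_3 -> Prop) : P 0 -> P 1 -> P 2%:R -> forall i, P i.
Proof.
move=> P0 P1 P2 [[|[|[|m]]] Hm] //.
- by rewrite (_ : Ordinal Hm = 0) //; apply: val_inj.
- by rewrite (_ : Ordinal Hm = 1) //; apply: val_inj.
- by rewrite (_ : Ordinal Hm = 2%:R) //; apply: val_inj.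
Qed.

Lemma row3P u v :
  u 0 0 = v 0 0 -> u 0 1 = v 0 1 -> u 0 2%:R = v 0 2%:R -> u = v.
Proof. by move=> h0 h1 h2; apply/rowP; elim/ord3_ind. Qed.

Lemma dotE u v :
  dot u v = u 0 0 * v 0 0 + u 0 1 * v 0 1 + u 0 2%:R * v 0 2%:R.
Proof.
rewrite /dot !big_ord_recl big_ord0 addr0 addrA.
by congr (_ + _ * _ + _ * _); congr (_ 0 _); apply: val_inj.
Qed.

Lemma crossE0 u v : cross u v 0 0 = u 0 1 * v 0 2%:R - u 0 2%:R * v 0 1.
Proof. by rewrite mxE. Qed.

Lemma crossE1 u v : cross u v 0 1 = u 0 2%:R * v 0 0 - u 0 0 * v 0 2%:R.
Proof. by rewrite mxE. Qed.

Lemma crossE2 u v : cross u v 0 2%:R = u 0 0 * v 0 1 - u 0 1 * v 0 0.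
Proof. by rewrite mxE. Qed.

Definition coordE := (dotE, crossE0, crossE1, crossE2).

End VectorAlgebra.

Ltac row_ring :=
  apply: row3P;
  repeat (rewrite ?coordE ?[fun_of_matrix (_ + _) _ _]mxE
    ?[fun_of_matrix (- _) _ _]mxE ?[fun_of_matrix (_ *: _) _ _]mxE
    ?[fun_of_matrix 0 _ _]mxE);
  ring.

Section Rotations.
Variable R : realType.
Implicit Types (u v w x : 'rV[R]_3) (k t : R) (q : quat R).

Lemma dotC u v : dot u v = dot v u.
Proof. by rewrite !dotE; ring. Qed.

Lemma dotDr u v w : dot u (v + w) = dot u v + dot u w.
Proof. by rewrite !dotE !mxE; ring. Qed.

Lemma dotNr u v : dot u (- v) = - dot u v.
Proof. by rewrite !dotE !mxE; ring. Qed.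

Lemma dotZr k u v : dot u (k *: v) = k * dot u v.
Proof. by rewrite !dotE !mxE; ring. Qed.

Lemma dotDl u v w : dot (u + v) w = dot u w + dot v w.
Proof. by rewrite !(dotC _ w) dotDr. Qed.

Lemma dotNl u v : dot (- u) v = - dot u v.
Proof. by rewrite !(dotC _ v) dotNr. Qed.

Lemma dotZl k u v : dot (k *: u) v = k * dot u v.
Proof. by rewrite !(dotC _ v) dotZr. Qed.

Lemma dot_crossr u v : dot u (cross u v) = 0.
Proof. by rewrite !coordE; ring. Qed.

Lemma crossZr k u v : cross u (k *: v) = k *: cross u v.
Proof. row_ring. Qed.

Lemma crossDr u v w : cross u (v + w) = cross u v + cross u w.
Proof. row_ring. Qed.

Lemma cross_cross u v : cross u (cross u v) = dot u v *: u - dot u u *: v.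
Proof. row_ring. Qed.

Lemma cross_add_cross k u v w :
  cross u (w + k *: cross u v)
  = (k * dot u v) *: u - (k * dot u u) *: v - cross w u.
Proof. row_ring. Qed.

Lemma dot_ge0 u : 0 <= dot u u.
Proof. by apply: sumr_ge0 => i _; rewrite -expr2 sqr_ge0. Qed.

Lemma dot_eq0 u : (dot u u == 0) = (u == 0).
Proof.
apply/idP/eqP => [|->]; last by rewrite /dot big1 // => i _; rewrite mxE mul0r.
rewrite psumr_eq0 => [/allP h|i _]; last by rewrite -expr2 sqr_ge0.
apply/rowP => i; rewrite mxE.
by have /h := mem_index_enum i; rewrite mulf_eq0 orbb => /eqP.
Qed.

Lemma dot_gt0 u : (0 < dot u u) = (u != 0).
Proof. by rewrite lt_def dot_ge0 andbT dot_eq0. Qed.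

Lemma enorm_sqr u : enorm u ^+ 2 = dot u u.
Proof. by rewrite sqr_sqrtr ?dot_ge0. Qed.

Lemma enorm_ge0 u : 0 <= enorm u.
Proof. exact: sqrtr_ge0. Qed.

Lemma enorm_gt0 u : (0 < enorm u) = (u != 0).
Proof. by rewrite sqrtr_gt0 dot_gt0. Qed.

Lemma enorm_eq0 u : (enorm u == 0) = (u == 0).
Proof. by rewrite -sqrf_eq0 enorm_sqr dot_eq0. Qed.

Lemma enormZ k u : 0 <= k -> enorm (k *: u) = k * enorm u.
Proof.
move=> k0; rewrite /enorm dotZl dotZr mulrA sqrtrM ?mulr_ge0 //.
by rewrite -expr2 sqrtr_sqr ger0_norm.
Qed.

Lemma sphere_normalize u : u != 0 -> sphere2 R ((enorm u)^-1 *: u).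
Proof.
move=> u0; rewrite /sphere2 /= enormZ ?invr_ge0 ?enorm_ge0 // mulVf //.
by rewrite enorm_eq0.
Qed.

Lemma sphere_neq0 u : sphere2 R u -> u != 0.
Proof. by rewrite /sphere2 /= -enorm_gt0 => ->. Qed.

Lemma sphere_dot u : sphere2 R u <-> dot u u = 1.
Proof.
rewrite -enorm_sqr; split=> [->|h]; first by rewrite expr1n.
have /eqP := h; rewrite sqrf_eq1 => /orP[/eqP//|/eqP h1].
by have := enorm_ge0 u; rewrite h1 oppr_ge0 ler10.
Qed.

(** Only the vector part of the product is kept: the scalar part is zero. *)
Definition qrot q v : 'rV[R]_3 := (qmul (qmul q (imq v)) (qconj q)).2.

Lemma qrotE q v :
  qrot q v = (q.1 ^+ 2 - dot q.2 q.2) *: v + (2 * dot q.2 v) *: q.2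
    + (2 * q.1) *: cross q.2 v.
Proof. case: q => r w; rewrite /qrot /=; row_ring. Qed.

Lemma qmul_conj q v :
  qmul (qmul (qconj q) (imq v)) q = imq (qrot (qconj q) v).
Proof.
case: q => r w; rewrite /qrot /qmul /=; congr pair.
  by rewrite !(coordE, mxE); ring.
by rewrite /qconj /= opprK.
Qed.

Lemma qrotD q u v : qrot q (u + v) = qrot q u + qrot q v.
Proof. rewrite !qrotE; row_ring. Qed.

Lemma qrotZ q k u : qrot q (k *: u) = k *: qrot q u.
Proof. rewrite !qrotE; row_ring. Qed.

Lemma unit_qconj q : unit_quat q -> unit_quat (qconj q).
Proof. by rewrite /unit_quat /= dotNl dotNr opprK. Qed.

(** For an arbitrary quaternion the identity holds up to a power of its squared
    norm, and in that form it is polynomial; likewise for [dot_qrot] and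
    [cross_qrot]. *)
Lemma qrotK q v : unit_quat q -> qrot (qconj q) (qrot q v) = v.
Proof.
move=> uq; transitivity ((q.1 ^+ 2 + dot q.2 q.2) ^+ 2 *: v).
  by rewrite !qrotE; case: q {uq} => r w /=; row_ring.
by rewrite uq expr1n scale1r.
Qed.

Lemma qrotVK q v : unit_quat q -> qrot q (qrot (qconj q) v) = v.
Proof.
move=> uq; have := qrotK v (unit_qconj uq).
by rewrite {1}/qconj /= opprK -surjective_pairing.
Qed.

Lemma dot_qrot q u v : unit_quat q -> dot (qrot q u) (qrot q v) = dot u v.
Proof.
move=> uq; transitivity ((q.1 ^+ 2 + dot q.2 q.2) ^+ 2 * dot u v).
  by rewrite !qrotE; case: q {uq} => r w /=; rewrite !(coordE, mxE); ring.
by rewrite uq expr1n mul1r.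
Qed.

Lemma cross_qrot q u v :
  unit_quat q -> cross (qrot q u) (qrot q v) = qrot q (cross u v).
Proof.
move=> uq.
transitivity ((q.1 ^+ 2 + dot q.2 q.2) *: qrot q (cross u v)).
  by rewrite !qrotE; case: q {uq} => r w /=; row_ring.
by rewrite uq scale1r.
Qed.

Lemma sphere_qrot q u : unit_quat q -> sphere2 R u -> sphere2 R (qrot q u).
Proof. by move=> uq /sphere_dot h; apply/sphere_dot; rewrite dot_qrot. Qed.

Lemma qrot1 u : qrot (1, 0) u = u.
Proof. rewrite qrotE /=; row_ring. Qed.

End Rotations.

(** * Differential calculus *)

Section Calculus.
Variable R : realType.
Implicit Types (U V W : normedModType R).

(** How remainder terms are disposed of: a function which is [o (y - x)] at [x]
    may be added or removed without changing the differential. *)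
Lemma is_diff_small V W (f : V -> W) (x : V) :
  (forall e, 0 < e -> \forall y \near x, `|f y| <= e * `|y - x|) ->
  is_diff x f (0 : V -> W).
Proof.
move=> fo.
have fx0 : f x = 0.
  have /nbhs_singleton := fo 1 ltr01.
  by rewrite subrr normr0 mulr0 normr_le0 => /eqP.
pose z : {linear V -> W} := \0.
have zc : continuous z by exact: cst_continuous.
have fe : f \o shift x = cst (f x) + z +o_ 0 id.
  apply/eqaddoP => e e0; rewrite fx0.
  have := fo e e0; rewrite (near_shift 0) subr0 /=.
  apply: filterS => y; rewrite /= !fctE /= addrK.
  by rewrite addr0 subr0.
have zE := diff_unique zc fe.
apply: DiffDef; last by rewrite zE.
by apply/diff_locallyP; split; rewrite zE.
Qed.

Lemma diff_approx V W (f : V -> W) (x : V) e :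
  differentiable f x -> 0 < e ->
  \forall y \near x, `|f y - f x - 'd f x (y - x)| <= e * `|y - x|.
Proof.
move=> df e0; have /diff_locally/eqaddoP/(_ _ e0) := df.
rewrite [in X in _ -> X](near_shift 0) subr0 /=.
by apply: filterS => y; rewrite /= !fctE /= addrK opprD addrA.
Qed.

Lemma near_eq_is_diff V W (f g df : V -> W) (x : V) :
  (\forall y \near x, f y = g y) -> is_diff x f df -> is_diff x g df.
Proof.
move=> fg dfx.
have -> : g = f + (g - f) by apply/funext => y; rewrite !fctE addrC subrK.
rewrite -[df]addr0; apply: is_diffD; apply: is_diff_small => e e0.
by apply: filterS fg => y; rewrite !fctE => ->; rewrite subrr normr0 mulr_ge0 // ltW.
Qed.

Lemma is_derive_chain V W (f : V -> W) (c : R -> V) (t : R) (v : V) :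
  differentiable f (c t) -> is_derive t 1 c v ->
  is_derive t 1 (f \o c) ('d f (c t) v).
Proof.
move=> df [/derivable1_diffP dc <-].
have dfc : differentiable (f \o c) t by exact: differentiable_comp.
apply: DeriveDef; first exact/derivable1_diffP.
by rewrite deriveE // diff_comp //= deriveE.
Qed.

Lemma linear_combB V (f : {linear V -> R}) (k l : R) (u v : V) :
  f (k *: u - l *: v) = k * f u - l * f v.
Proof. by rewrite linearB !linearZZ. Qed.

Lemma diff_chain U V W (f df : U -> V) (g : V -> W) x v :
  is_diff x f df -> differentiable g (f x) ->
  'd (g \o f) x v = 'd g (f x) (df v).
Proof.
by move=> [dfx fE] dg; rewrite (@diff_comp R U V W f g x dfx dg) /= fE.
Qed.

(** Zero velocity means that the displacement is [o (t)], which a Lipschitz map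
    preserves, whether or not it is differentiable. *)
Lemma is_derive_lipschitz0 V W (f : V -> W) (c : R -> V) (k t : R) :
  (forall x y, `|f x - f y| <= k * `|x - y|) ->
  is_derive t 1 c 0 -> is_derive t 1 (f \o c) 0.
Proof.
move=> fk [/derivable1_diffP dc c0].
have k0 : 0 < `|k| + 1 by rewrite ltr_wpDl.
have dc0 h : 'd c t h = 0.
  by rewrite -[h]mulr1 [h * 1]/(h *: 1) linearZZ -deriveE // c0 scaler0.
have : is_diff t (fun s => f (c s) - f (c t)) (0 : R -> W).
  apply: is_diff_small => e e0.
  have := diff_approx dc (divr_gt0 e0 k0).
  apply: filterS => y; rewrite dc0 subr0 => h.
  apply: (le_trans (fk _ _)).
  apply: (@le_trans _ _ ((`|k| + 1) * `|c y - c t|)).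
    by rewrite ler_wpM2r // (le_trans (ler_norm k)) // lerDl.
  by rewrite -ler_pdivlMl // mulrA [_^-1 * _]mulrC.
move=> dfc.
have : is_derive t 1 ((fun s => f (c s) - f (c t)) + cst (f (c t))) (0 + 0).
  apply: is_deriveD; apply: DeriveDef; first exact/derivable1_diffP/ex_diff.
  by rewrite deriveE ?diff_val //; apply: ex_diff.
rewrite addr0; congr (is_derive _ _ _ _).
by apply/funext => s; rewrite !fctE subrK.
Qed.

Lemma is_derive_bound (f : R -> R) (k t d : R) :
  (forall s, `|f s - f t| <= k * `|s - t|) ->
  is_derive t 1 f d -> `|d| <= k.
Proof.
move=> fk [/derivable1_diffP df fd].
apply/ler_addgt0Pr => e e0.
have [r r0 hr] := (nbhs_ballP _ _).1 (diff_approx df e0).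
have /hr : ball t r (t + r / 2).
  rewrite /ball /= opprD addrA subrr sub0r normrN gtr0_norm ?divr_gt0 //.
  by rewrite ltr_pdivrMr // ltr_pMr // ltr1n.
have {hr} : (t + r / 2) - t = r / 2 by rewrite addrAC subrr add0r.
set s := t + r / 2 => sE; rewrite /= sE.
have s0 : 0 < r / 2 by rewrite divr_gt0.
have -> : 'd f t (r / 2) = (r / 2) * d.
  by rewrite -[X in 'd f t X]mulr1 [X in 'd f t X]/(_ *: 1) linearZZ -deriveE // fd.
have := fk s; rewrite sE (gtr0_norm s0) => h1 h2.
have : `|r / 2 * d| <= (k + e) * (r / 2).
  rewrite mulrDl -[r / 2 * d](subKr (f s - f t)).
  by apply: (le_trans (ler_normB _ _)); rewrite lerD.
by rewrite normrM (gtr0_norm s0) mulrC ler_pM2r.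
Qed.

Lemma differentiable_row V n (f : V -> 'rV[R]_n) x :
  (forall j, differentiable (fun y => f y 0 j) x) -> differentiable f x.
Proof.
move=> df.
have -> : f = \sum_(j < n) (fun y => f y 0 j *: delta_mx 0 j).
  by apply/funext => y; rewrite fct_sumE -row_sum_delta.
by apply: differentiable_sum => j; exact: differentiableZl.
Qed.

Lemma is_derive_row V n (f : V -> 'rV[R]_n) (x v : V) (w : 'rV[R]_n) :
  (forall j, is_derive x v (fun y => f y 0 j) (w 0 j)) -> is_derive x v f w.
Proof.
move=> df.
have dv : derivable f x v.
  by apply/derivable_mxP => i j; rewrite ord1; have [] := df j.
apply: DeriveDef => //; rewrite derive_mx //.
by apply/rowP => j; rewrite mxE; have [_ ] := df j.
Qed.

Lemma is_derive_coord V n (f : V -> 'rV[R]_n) (x v : V) (w : 'rV[R]_n) j :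
  is_derive x v f w -> is_derive x v (fun y => f y 0 j) (w 0 j).
Proof.
move=> [df <-]; apply: DeriveDef; first by move/derivable_mxP : df.
by rewrite derive_mx // mxE.
Qed.

Lemma is_derive_scale V n (k : V -> R) (f : V -> 'rV[R]_n) (x v : V) a w :
  is_derive x v k a -> is_derive x v f w ->
  is_derive x v (fun y => k y *: f y) (k x *: w + a *: f x).
Proof.
move=> dk df; apply: is_derive_row => j.
have -> : (fun y => (k y *: f y) 0 j) = k * (fun y => f y 0 j).
  by apply/funext => y; rewrite mxE.
rewrite !mxE [a * _]mulrC; apply: is_deriveM.
exact: is_derive_coord.
Qed.

Lemma is_derive_line n (x a : 'rV[R]_n) (t : R) :
  is_derive t 1 (fun s : R => x + s *: a) a.
Proof.
have := is_deriveD (is_derive_cst x t 1)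
  (is_derive_scale (is_derive_id t 1) (is_derive_cst a t 1)).
by rewrite scaler0 !add0r scale1r.
Qed.

Lemma differentiable_scale V n (k : V -> R) (f : V -> 'rV[R]_n) x :
  differentiable k x -> differentiable f x ->
  differentiable (fun y => k y *: f y) x.
Proof.
move=> dk df; apply: differentiable_row => j.
have -> : (fun y => (k y *: f y) 0 j) = k * (fun y => f y 0 j).
  by apply/funext => y; rewrite mxE.
apply: differentiableM => //.
exact: (differentiable_comp df (differentiable_coord _ _ _)).
Qed.

Lemma differentiable_mulmx n (B : 'M[R]_n) (x : 'rV[R]_n) :
  differentiable (fun y => y *m B) x.
Proof.
apply: differentiable_row => j.
have -> : (fun y : 'rV[R]_n => (y *m B) 0 j)
    = \sum_(k < n) ((fun y : 'rV[R]_n => y 0 k) * cst (B k j)).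
  by apply/funext => y; rewrite mxE fct_sumE.
apply: differentiable_sum => k; apply: differentiableM; last by [].
exact: differentiable_coord.
Qed.

Lemma is_derive_dot V (f g : V -> 'rV[R]_3) (x v : V) (a b : 'rV[R]_3) :
  is_derive x v f a -> is_derive x v g b ->
  is_derive x v (fun y => dot (f y) (g y)) (dot (f x) b + dot a (g x)).
Proof.
move=> df dg.
have -> : (fun y => dot (f y) (g y))
    = \sum_i ((fun y => f y 0 i) * (fun y => g y 0 i)).
  by apply/funext => y; rewrite fct_sumE.
rewrite [dot a _]dotC /dot -big_split /=.
apply: is_derive_sum => i; apply: is_deriveM; exact: is_derive_coord.
Qed.

Lemma differentiable_enorm (x : 'rV[R]_3) :
  x != 0 -> differentiable (@enorm R) x.
Proof.
move=> x0.
apply: (differentiable_comp (f := fun y : 'rV[R]_3 => dot y y)).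
  have -> : (fun y : 'rV[R]_3 => dot y y)
      = \sum_i ((fun y : 'rV[R]_3 => y 0 i) * (fun y : 'rV[R]_3 => y 0 i)).
    by apply/funext => y; rewrite fct_sumE.
  by apply: differentiable_sum => i; apply: differentiableM;
    exact: differentiable_coord.
by apply/derivable1_diffP; have [] := is_derive1_sqrt (x := dot x x);
  rewrite ?dot_gt0.
Qed.

Section Homogeneous.
Variables (V : normedModType R) (f : V -> R).
Implicit Types (x v : V) (t : R).

Lemma diff_homogeneous1 t x v : t != 0 -> (forall y, f (t *: y) = t * f y) ->
  differentiable f x -> differentiable f (t *: x) ->
  'd f (t *: x) v = 'd f x v.
Proof.
move=> t0 ft dx dtx; apply: (mulfI t0).
transitivity ('d f (t *: x) (t *: v)); first by rewrite linearZZ.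
rewrite -(@diff_chain _ _ _ ( *:%R t) ( *:%R t) f x v (is_diff_scaler t x) dtx).
have -> : f \o ( *:%R t) = t *: f by apply/funext => y; rewrite !fctE /= ft.
by rewrite (diffZ t dx).
Qed.

Lemma diff_homogeneous0 t x v : (forall y, f (t *: y) = f y) ->
  differentiable f (t *: x) -> 'd f (t *: x) (t *: v) = 'd f x v.
Proof.
move=> ft dtx.
rewrite -(@diff_chain _ _ _ ( *:%R t) ( *:%R t) f x v (is_diff_scaler t x) dtx).
by have -> : f \o ( *:%R t) = f by apply/funext => y; rewrite /= ft.
Qed.

Let is_derive_ray x : differentiable f x ->
  is_derive (1 : R) 1 (fun t : R => f (t *: x)) ('d f x x).
Proof.
move=> dx; have d1 : differentiable f (1 *: x) by rewrite scale1r.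
have [ds vs] := is_diff_scalel 1 x.
have dr : is_derive (1 : R) 1 ( *:%R ^~ x) x.
  apply: DeriveDef; first exact/derivable1_diffP.
  by rewrite deriveE // vs scale1r.
by have := is_derive_chain d1 dr; rewrite scale1r.
Qed.

Let near1_gt0 : \forall t \near (1 : R), 0 < t.
Proof. by apply: lt_nbhsr; exact: ltr01. Qed.

(** Euler's relation: differentiate [f (t x)] at [t = 1]. *)
Lemma euler_homogeneous1 x : (forall t, 0 < t -> f (t *: x) = t * f x) ->
  differentiable f x -> 'd f x x = f x.
Proof.
move=> fx dx; have [_ <-] := is_derive_ray dx.
have dlin : is_derive (1 : R) 1 (id * cst (f x)) (f x).
  have := is_deriveM (is_derive_id (1 : R) 1) (is_derive_cst (f x) (1 : R) 1).
  by rewrite scaler0 add0r [_ *: _]mulr1.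
have [_ <-] := dlin; apply: near_eq_derive.
by apply: filterS near1_gt0 => t t0; rewrite !fctE fx.
Qed.

Lemma euler_homogeneous0 x : (forall t, 0 < t -> f (t *: x) = f x) ->
  differentiable f x -> 'd f x x = 0.
Proof.
move=> fx dx; have [_ <-] := is_derive_ray dx.
have [_ <-] := is_derive_cst (f x) (1 : R) 1; apply: near_eq_derive.
by apply: filterS near1_gt0 => t t0; rewrite fx.
Qed.

End Homogeneous.

End Calculus.

Section Lift.
Variables (R : realType) (n : nat).
Implicit Types (V W : normedModType R).

(** With [psi] the affine inverse of the first order expansion of [F] at [s],
    [F (psi x) - x] is [o (x - F s)].  As [p] is Lipschitz, [p x] differs from
    [p (F (psi x)) = N (psi x)] by as little, and [N \o psi] is differentiable. *)
Lemma differentiable_of_lift (p N : 'rV[R]_n -> R) (F : 'rV[R]_n -> 'rV[R]_n)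
    (k : R) (s : 'rV[R]_n) :
  (forall x y, `|p x - p y| <= k * `|x - y|) ->
  differentiable F s -> differentiable N s ->
  (\forall y \near s, p (F y) = N y) ->
  (forall w, 'd F s w = 0 -> w = 0) ->
  differentiable p (F s).
Proof.
move=> pk dF dN pF injF.
pose A := lin1_mx ('d F s); pose B := invmx A.
have Au : A \in unitmx.
  by rewrite -row_free_unit; apply: inj_row_free => v; rewrite mul_rV_lin1; exact: injF.
pose psi (x : 'rV[R]_n) := (x - F s) *m B + s.
have dpsi x : differentiable psi x.
  have dc : differentiable (id - cst (F s)) x by exact: differentiableB.
  have dm := differentiable_comp dc (differentiable_mulmx B _).
  exact: (differentiableD dm (differentiable_cst s x)).
have psiF : psi (F s) = s by rewrite /psi subrr mul0mx add0r.
have cpsi : psi @ F s --> s.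
  by rewrite -[X in _ --> X]psiF; exact: differentiable_continuous.
have [b b0 hb] : exists2 b, 0 < b & forall x : 'rV[R]_n, `|x *m B| <= b * `|x|.
  have [|b b0 hb] := @linear_lipschitz R _ _ (mulmxr B : {linear 'rV[R]_n -> 'rV[R]_n}).
    by move=> x; apply: differentiable_continuous; exact: differentiable_mulmx.
  by exists b.
have k1 : 0 < `|k| + 1 by rewrite ltr_wpDl.
have dq : is_diff (F s) (fun x => p x - N (psi x)) (0 : _ -> R).
  apply: is_diff_small => e e0.
  have e1 : 0 < e / ((`|k| + 1) * b) by rewrite divr_gt0 // mulr_gt0.
  have h1 := cpsi _ (diff_approx dF e1); have h2 := cpsi _ pF.
  near=> x.
  have <- : p (F (psi x)) = N (psi x) by near: x; exact: h2.
  have : `|F (psi x) - F s - 'd F s (psi x - s)|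
      <= e / ((`|k| + 1) * b) * `|psi x - s| by near: x; exact: h1.
  have -> : 'd F s (psi x - s) = x - F s.
    by rewrite -[LHS](mul_rV_lin1 ('d F s)) -/A /psi addrK -mulmxA mulVmx // mulmx1.
  have -> : psi x - s = (x - F s) *m B by rewrite /psi addrK.
  rewrite opprB addrA subrK => hF.
  apply: (le_trans (pk _ _)); rewrite distrC.
  apply: (@le_trans _ _ ((`|k| + 1) * `|F (psi x) - x|)).
    by rewrite ler_wpM2r // (le_trans (ler_norm k)) // lerDl.
  rewrite -ler_pdivlMl //; apply: (le_trans hF).
  apply: (@le_trans _ _ (e / ((`|k| + 1) * b) * (b * `|x - F s|))).
    by apply: ler_wpM2l; [exact: ltW | exact: hb].
  rewrite (_ : _ / _ * _ = (`|k| + 1)^-1 * (e * `|x - F s|)) //.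
  by field; rewrite !gt_eqF.
have -> : p = (fun x => p x - N (psi x)) + (N \o psi).
  by apply/funext => x; rewrite !fctE /= subrK.
apply: differentiableD; first exact: ex_diff.
by apply: differentiable_comp; rewrite ?psiF.
Unshelve. all: by end_near. Qed.

End Lift.

Section Local.
Variable R : realType.
Implicit Types (U V W : normedModType R).

Lemma C1_on_local V W (A : set V) (f : V -> W) x :
  C1_on A f -> A x ->
  exists F : V -> W, differentiable F x /\ \forall y \near x, A y -> f y = F y.
Proof.
move=> fA Ax; have [U [F [oU Ux dF fF]]] := fA x Ax.
exists F; split; first by have [] := dF x Ux.
apply: filterS (open_nbhs_nbhs (conj oU Ux)) => y Uy Ay.
by apply: fF; rewrite inE.
Qed.

(** At one given point, a map of class C^1 on a set may be traded for an
    ambient differentiable map, as long as it is applied to points of the set. *)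
Lemma C1_on_comp U V W (A : set V) (f : V -> W) (u : U -> V) x :
  C1_on A f -> {for x, continuous u} -> (\forall y \near x, A (u y)) ->
  exists F : V -> W,
    differentiable F (u x) /\ \forall y \near x, f (u y) = F (u y).
Proof.
move=> fA cu Au.
have [F [dF fF]] := C1_on_local fA (nbhs_singleton Au).
exists F; split => //.
have fF' : \forall y \near x, A (u y) -> f (u y) = F (u y) by exact: cu _ fF.
near=> y; have Auy : A (u y) by near: y.
by move: Auy; near: y.
Unshelve. all: by end_near. Qed.

Lemma differentiable_C1_on U V W (A : set V) (f : V -> W) (u : U -> V) x :
  C1_on A f -> differentiable u x -> (\forall y \near x, A (u y)) ->
  differentiable (f \o u) x.
Proof.
move=> fA du Au.
have [F [dF fF]] := C1_on_comp fA (differentiable_continuous du) Au.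
have /differentiableP dFu := differentiable_comp du dF.
apply: (ex_diff (is_diff_def := near_eq_is_diff _ dFu)).
by apply: filterS fF => y /= ->.
Qed.

Lemma is_derive_C1_on0 V W (A : set V) (f : V -> W) (c : R -> V) (t : R) :
  C1_on A f -> is_derive t 1 c 0 -> (\forall s \near t, A (c s)) ->
  is_derive t 1 (f \o c) 0.
Proof.
move=> fA dc Ac.
have dcc : {for t, continuous c}.
  by apply/differentiable_continuous/derivable1_diffP; have [] := dc.
have [F [dF fF]] := C1_on_comp fA dcc Ac.
have := is_derive_chain dF dc; rewrite linear0.
by apply: near_eq_is_derive; apply: filterS fF => y /= ->.
Qed.

End Local.

(** * Gradients on the unit sphere *)

Section SphereGradient.
Variable R : realType.
Implicit Types (x a eta : 'rV[R]_3) (t : R).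

(** The radial projection of the tangent line: [a] is orthogonal to [eta], so
    the norm along this line is stationary at 0 and the projection keeps the
    velocity [a]. *)
Lemma sphere_curve eta a : sphere2 R eta -> dot eta a = 0 ->
  exists c : R -> 'rV[R]_3,
    [/\ forall t, sphere2 R (c t), c 0 = eta & is_derive (0 : R) 1 c a].
Proof.
move=> e1 ea; pose l (t : R) := eta + t *: a.
have dl : is_derive (0 : R) 1 l a by exact: is_derive_line.
have l0 : l 0 = eta by rewrite /l scale0r addr0.
have ee : dot eta eta = 1 by apply/sphere_dot.
have ln0 t : l t != 0.
  apply/eqP => lt0; have : dot eta (l t) = 1 by rewrite dotDr dotZr ea mulr0 addr0.
  by rewrite lt0 -(scale0r 0) dotZr mul0r => /esym/eqP; rewrite oner_eq0.
have dN : is_derive (0 : R) 1 (fun t => enorm (l t)) 0.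
  have dN := is_derive_chain (differentiable_enorm (ln0 0)) dl.
  suff d0 : 'd (@enorm R) (l 0) a = 0 by rewrite d0 in dN.
  have d2 := is_deriveM dN dN; have d2' := is_derive_dot dl dl.
  have e2 : (@enorm R \o l) * (@enorm R \o l) = fun t => dot (l t) (l t).
    by apply/funext => t; rewrite -enorm_sqr.
  rewrite e2 in d2; have [_ v2] := d2; have [_] := d2'.
  rewrite v2 /= l0 [dot a eta]dotC ea addr0 e1 !scale1r => /eqP.
  by rewrite -mulr2n mulrn_eq0 => /eqP.
exists (fun t => (enorm (l t))^-1 *: l t); split.
- by move=> t; exact: sphere_normalize.
- by rewrite l0 e1 invr1 scale1r.
have Nc : enorm (l 0) != 0 by rewrite enorm_eq0.
have dV := @is_deriveV R (fun t => enorm (l t)) 0 0 1 Nc dN.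
have := is_derive_scale dV dl.
by rewrite scaler0 scale0r addr0 l0 e1 invr1 scale1r.
Qed.

Definition gradient (F : 'rV[R]_3 -> R) x : 'rV[R]_3 :=
  \row_j 'd F x (delta_mx 0 j).

Lemma dot_gradient (F : 'rV[R]_3 -> R) x a : dot (gradient F x) a = 'd F x a.
Proof.
rewrite {2}[a]row_sum_delta linear_sum; apply: eq_bigr => j _.
by rewrite mxE linearZ mulrC.
Qed.

(** The tangential part of the ambient gradient of [F] is a spherical gradient
    of [f], so [sphere_grad f eta] is one as well, and it is determined on
    tangent vectors by curves on the sphere. *)
Lemma dot_sphere_grad (f F : 'rV[R]_3 -> R) eta a :
  (forall x, sphere2 R x -> f x = F x) -> differentiable F eta ->
  sphere2 R eta -> dot eta a = 0 -> dot (sphere_grad f eta) a = 'd F eta a.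
Proof.
move=> fF dF e1 ea.
have fc (c : R -> 'rV[R]_3) v : (forall t, sphere2 R (c t)) -> c 0 = eta ->
    is_derive (0 : R) 1 c v -> is_derive (0 : R) 1 (f \o c) ('d F eta v).
  move=> c1 c0 dc; have -> : f \o c = F \o c.
    by apply/funext => t; exact: fF.
  by rewrite -c0; apply: is_derive_chain; rewrite ?c0.
have ee : dot eta eta = 1 by apply/sphere_dot.
pose n := gradient F eta.
have grad_ex : is_sphere_grad f eta (n - dot n eta *: eta).
  split=> [|c c1 c0 dc]; first by rewrite dotDl dotNl dotZl ee mulr1 subrr.
  have /derivableP dcv := dc.
  suff -> : dot (n - dot n eta *: eta) ('D_1 c 0) = 'd F eta ('D_1 c 0).
    exact: fc dcv.
  rewrite dotDl dotNl dotZl dot_gradient.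
  suff -> : dot eta ('D_1 c 0) = 0 by rewrite mulr0 subr0.
  have := is_derive_dot dcv dcv; rewrite c0 [dot _ eta]dotC => d1.
  have d0 : is_derive (0 : R) 1 (fun t => dot (c t) (c t)) 0.
    have -> : (fun t => dot (c t) (c t)) = cst 1.
      by apply/funext => t; apply/sphere_dot.
    exact: is_derive_cst.
  have : dot eta ('D_1 c 0) + dot eta ('D_1 c 0) = 0.
    by have [_ <-] := d1; have [_ ->] := d0.
  by move/eqP; rewrite -mulr2n mulrn_eq0 => /eqP.
have [_ /= gradP] : is_sphere_grad f eta (sphere_grad f eta).
  exact: (@getPex _ [set g | is_sphere_grad f eta g] (ex_intro _ _ grad_ex)).
have [c [c1 c0 dc]] := sphere_curve e1 ea.
have := gradP c c1 c0; have [d_c vc] := dc; rewrite vc => /(_ d_c)[_ <-].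
by have [_ ->] := fc c a c1 c0 dc.
Qed.

End SphereGradient.

(** * Minkowski gauge of a convex open set *)

Section Gauge.
Variables (R : realType) (V : normedModType R).
Implicit Types (A : set V) (c x y : V) (r s t : R).

Definition gauge A c x : R := inf [set r | 0 < r /\ A (c + r^-1 *: x)].

Variables (A : set V) (c : V).
Hypotheses (openA : open A) (convA : convex_set A) (Ac : A c).
Hypothesis boundA : bounded_set A.

Local Notation p := (gauge A c).

Let convAE x y t : 0 <= t -> t <= 1 -> A x -> A y -> A (t *: x + (1 - t) *: y).
Proof.
move=> t0 t1 Ax Ay.
have := @convA x y (@Itv01 R t t0 t1) (mem_set Ax) (mem_set Ay).
by rewrite inE.
Qed.

Let mem_le x r s : 0 < r -> r <= s -> A (c + r^-1 *: x) -> A (c + s^-1 *: x).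
Proof.
move=> r0 rs Ar; have s0 := lt_le_trans r0 rs.
have -> : c + s^-1 *: x = (r / s) *: (c + r^-1 *: x) + (1 - r / s) *: c.
  rewrite scalerDr scalerA [r / s / r]mulrAC divff ?gt_eqF // mul1r.
  by rewrite addrAC -scalerDl addrCA subrr addr0 scale1r.
apply: convAE => //; first by rewrite divr_ge0 ?ltW.
by rewrite ler_pdivrMr // mul1r.
Qed.

Let absorbing : exists2 k, 0 < k & forall x r, k * `|x| < r -> A (c + r^-1 *: x).
Proof.
have [e /= e0 he] := (nbhs_ballP _ _).1 (open_nbhs_nbhs (conj openA Ac)).
exists e^-1 => [|x r xr]; first by rewrite invr_gt0.
have r0 : 0 < r by apply: le_lt_trans xr; rewrite mulr_ge0 // invr_ge0 ltW.
apply: he; rewrite -ball_normE /= opprD addrA subrr sub0r normrN normrZ.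
rewrite gtr0_norm ?invr_gt0 // mulrC ltr_pdivrMr // mulrC.
by rewrite -ltr_pdivrMr // mulrC.
Qed.

Let gauge_ne x : [set r | 0 < r /\ A (c + r^-1 *: x)] !=set0.
Proof.
have [k k0 hk] := absorbing; exists (k * `|x| + 1); split.
  by rewrite ltr_wpDl // mulr_ge0 // ltW.
by apply: hk; rewrite ltrDl.
Qed.

Lemma gauge_ge0 x : 0 <= p x.
Proof. by apply: lb_le_inf => [|r [/ltW]//]; exact: gauge_ne. Qed.

(** Since [A] is open, the infimum that defines the gauge is not attained:
    strict inequality characterizes membership. *)
Lemma gauge_ltP x r : 0 < r -> p x < r <-> A (c + r^-1 *: x).
Proof.
move=> r0; split=> [/(inf_lt (gauge_ne x))[s [s0 As] /ltW sr]|Ar].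
  exact: mem_le As.
have [e /= e0 he] := (nbhs_ballP _ _).1 (open_nbhs_nbhs (conj openA Ar)).
pose d := e / (r^-1 * `|x| + 1).
have d1 : 0 < r^-1 * `|x| + 1 by rewrite ltr_wpDl // mulr_ge0 // invr_ge0 ltW.
have d0 : 0 < d by rewrite divr_gt0.
have D0 : 0 < 1 + d by rewrite addr_gt0.
apply: (@le_lt_trans _ _ (r / (1 + d))); last first.
  by rewrite ltr_pdivrMr // mulrDr mulr1 ltrDl mulr_gt0.
apply: ge_inf; first by exists 0 => s [/ltW].
split; first by rewrite divr_gt0.
apply: he; rewrite -ball_normE /= opprD addrACA subrr add0r -scalerBl normrZ.
rewrite invf_div mulrDl mul1r opprD addrA subrr sub0r normrN.
rewrite gtr0_norm ?divr_gt0 // -mulrA /d mulrAC ltr_pdivrMr //.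
by rewrite mulrDr mulr1 ltrDl.
Qed.

Lemma gauge_lt1 x : A (c + x) <-> p x < 1.
Proof. by rewrite gauge_ltP // invr1 scale1r. Qed.

Let gauge_le_of x t : 0 <= t -> (forall r, t < r -> A (c + r^-1 *: x)) -> p x <= t.
Proof.
move=> t0 h; apply/ler_addgt0Pr => e e0; apply/ltW/gauge_ltP.
  by rewrite ltr_wpDl.
by apply: h; rewrite ltrDl.
Qed.

Lemma gauge_upper : exists2 k, 0 < k & forall x, p x <= k * `|x|.
Proof.
have [k k0 hk] := absorbing; exists k => // x.
by apply: gauge_le_of => [|r]; [rewrite mulr_ge0 // ltW | exact: hk].
Qed.

(** Bounded sets do not contain a ray, which is what keeps the gauge positive. *)
Lemma gauge_lower : exists2 k, 0 < k & forall x, `|x| <= k * p x.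
Proof.
have [M M0 hM] := ex_strict_bound_gt0 boundA.
have k0 : 0 < M + `|c| by rewrite ltr_wpDr.
exists (M + `|c|) => // x; rewrite -ler_pdivrMl //.
apply/ler_addgt0Pr => e e0.
have r0 : 0 < p x + e by rewrite ltr_wpDl // gauge_ge0.
have /hM /= : A (c + (p x + e)^-1 *: x) by apply/gauge_ltP; rewrite ?ltrDl.
set z := c + _ => zM.
have -> : `|x| = (p x + e) * `|z - c|.
  rewrite -[p x + e in RHS]gtr0_norm // -normrZ /z addrAC subrr add0r scalerA.
  by rewrite divff ?gt_eqF // scale1r.
rewrite mulrCA ger_pMr // ler_pdivrMl // mulr1.
by rewrite (le_trans (ler_normB _ _)) // lerD2r ltW.
Qed.

Lemma gauge0 : p 0 = 0.
Proof.
have [k _ hk] := gauge_upper; apply/le_anti; rewrite gauge_ge0 andbT.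
by have := hk 0; rewrite normr0 mulr0.
Qed.

Lemma gauge_gt0 x : x != 0 -> 0 < p x.
Proof.
have [k k0 hk] := gauge_lower; rewrite -normr_gt0 => /lt_le_trans /(_ (hk x)).
by rewrite pmulr_rgt0.
Qed.

Lemma gaugeZ t x : 0 < t -> p (t *: x) = t * p x.
Proof.
have le s y : 0 < s -> p (s *: y) <= s * p y.
  move=> s0; apply: gauge_le_of => [|r]; first by rewrite mulr_ge0 ?gauge_ge0 // ltW.
  rewrite -ltr_pdivlMl // => yr; have r0 := le_lt_trans (gauge_ge0 y) yr.
  move/(gauge_ltP _ r0) : yr; congr (A (c + _)).
  by rewrite scalerA invfM invrK mulrC.
move=> t0; apply/le_anti; rewrite le //=.
have tn0 : t != 0 by rewrite gt_eqF.
rewrite -ler_pdivlMl // -[x in leLHS](scalerK tn0).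
by rewrite le // invr_gt0.
Qed.

Lemma gaugeD x y : p (x + y) <= p x + p y.
Proof.
apply/ler_addgt0Pr => e e0.
have r0 : 0 < p x + e / 2 by rewrite ltr_wpDl ?gauge_ge0 // divr_gt0.
have s0 : 0 < p y + e / 2 by rewrite ltr_wpDl ?gauge_ge0 // divr_gt0.
have Ar : A (c + (p x + e / 2)^-1 *: x).
  by apply/gauge_ltP; rewrite // ltrDl divr_gt0.
have As : A (c + (p y + e / 2)^-1 *: y).
  by apply/gauge_ltP; rewrite // ltrDl divr_gt0.
rewrite (_ : p x + p y + e = (p x + e / 2) + (p y + e / 2)); last by field.
move: (p x + e / 2) (p y + e / 2) r0 s0 Ar As => r s r0 s0 Ar As.
have rs0 : 0 < r + s by rewrite addr_gt0.
apply/ltW/gauge_ltP => //.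
have -> : c + (r + s)^-1 *: (x + y)
    = (r / (r + s)) *: (c + r^-1 *: x) + (1 - r / (r + s)) *: (c + s^-1 *: y).
  have -> : 1 - r / (r + s) = s / (r + s) by field; rewrite gt_eqF.
  rewrite !scalerDr !scalerA addrACA -scalerDl -mulrDl divff ?gt_eqF // scale1r.
  rewrite ![_ / (r + s) / _]mulrAC !divff ?gt_eqF // !mul1r.
  by [].
apply: convAE => //; first by rewrite divr_ge0 ?ltW.
by rewrite ler_pdivrMr // mul1r lerDl ltW.
Qed.

Lemma gauge_lipschitz :
  exists2 k, 0 < k & forall x y, `|p x - p y| <= k * `|x - y|.
Proof.
have [k k0 hk] := gauge_upper; exists k => // x y.
have h z w : p z - p w <= k * `|z - w|.
  by rewrite lerBlDl (le_trans _ (lerD (lexx _) (hk _))) // -[z in leLHS](subrKC w) gaugeD.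
by rewrite ler_norml h andbT lerNl opprB (le_trans (h y x)) // distrC.
Qed.

Lemma gauge_le1 x : closure A (c + x) <-> p x <= 1.
Proof.
split=> [Ax|px].
  have [k k0 hk] := gauge_lipschitz.
  apply/ler_addgt0Pr => e e0.
  have [y [Ay]] := Ax _ (nbhsx_ballx _ _ (divr_gt0 e0 k0)).
  rewrite -ball_normE /= ltr_pdivlMr // mulrC => /ltW xy.
  have py : p (y - c) < 1 by apply/gauge_lt1; rewrite subrKC.
  rewrite -[p x](subrK (p (y - c))) addrC lerD //; first exact: ltW.
  apply: (le_trans (ler_norm _)); apply: (le_trans (hk _ _)).
  by rewrite opprB addrCA addrA.
move=> U /nbhs_ballP[e /= e0 he].
pose d := e / (`|x| + 1).
have d1 : 0 < `|x| + 1 by rewrite ltr_wpDl.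
have d0 : 0 < d by rewrite divr_gt0.
have D0 : 0 < 1 + d by rewrite addr_gt0.
exists (c + (1 + d)^-1 *: x); split.
  apply/gauge_lt1; rewrite gaugeZ ?invr_gt0 // ltr_pdivrMl // mulr1.
  by rewrite (le_lt_trans px) // ltrDl.
apply: he; rewrite -ball_normE /= opprD addrACA subrr add0r.
rewrite -[x in x - _]scale1r -scalerBl normrZ.
have -> : 1 - (1 + d)^-1 = d / (1 + d) by field; rewrite gt_eqF.
rewrite gtr0_norm ?divr_gt0 //.
apply: (@le_lt_trans _ _ (d * `|x|)).
  by rewrite ler_wpM2r // ler_pdivrMr // ler_pMr // lerDl ltW.
by rewrite /d mulrAC ltr_pdivrMr // mulrDr mulr1 ltrDl.
Qed.

Lemma gauge_eq1 x : (closure A `\` interior A) (c + x) <-> p x = 1.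
Proof.
have -> : interior A = A by apply/interior_id.
split=> [[/gauge_le1 le1 nA]|p1].
  apply/le_anti; rewrite le1 /= leNgt; apply/negP => /gauge_lt1; exact: nA.
split; first by apply/gauge_le1; rewrite p1.
by move/gauge_lt1; rewrite p1 ltxx.
Qed.

End Gauge.

(** * Gronwall's inequality and rotations about an axis *)

Section Gronwall.
Variable R : realType.

(** The product of [h] with [exp (- k t)] is nonincreasing. *)
Lemma gronwall_ge0 (h dh : R -> R) (k : R) :
  (forall t : R, is_derive t 1 h (dh t)) -> (forall t, dh t <= k * h t) ->
  h 0 = 0 -> forall t, 0 <= t -> h t <= 0.
Proof.
move=> dhP dhk h0 t t0.
pose e (s : R) := expR (- k * s).
have de (s : R) : is_derive s 1 e (- k * e s).
  have dl : is_derive s 1 (fun s : R => - k * s) (- k).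
    have := is_deriveZ (- k) (is_derive_id s 1).
    by rewrite [_ *: 1]mulr1.
  have := is_derive1_comp (is_derive_expR (- k * s)) dl.
  by rewrite mulrC.
have dhe (s : R) : is_derive s 1 (h * e) ((dh s - k * h s) * e s).
  have := is_deriveM (dhP s) (de s).
  by congr (is_derive _ _ _ _); rewrite /GRing.scale /=; ring.
have cnt : continuous (h * e).
  move=> s; apply/differentiable_continuous/derivable1_diffP.
  by have [] := dhe s.
have : (h * e) t <= (h * e) 0.
  apply: (@ler0_derive1_nincry _ (h * e) 0) => // [s _|].
  - rewrite derive1E; have [_ ->] := dhe s.
    by rewrite mulr_le0_ge0 ?expR_ge0 // subr_le0.
  - exact: continuous_subspaceT.
by rewrite !fctE h0 mul0r pmulr_lle0 // expR_gt0.
Qed.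

Lemma gronwall_eq0 (h dh : R -> R) (k : R) :
  (forall t : R, is_derive t 1 h (dh t)) -> (forall t, `|dh t| <= k * h t) ->
  (forall t, 0 <= h t) -> h 0 = 0 -> forall t, h t = 0.
Proof.
move=> dhP dhk h_ge0 h0 t; apply/le_anti; rewrite h_ge0 andbT.
have [t0|/ltW t0] := leP 0 t.
  apply: (gronwall_ge0 dhP _ h0 t0) => s.
  exact: (le_trans (ler_norm _) (dhk s)).
rewrite -[t]opprK; have {}t0 : 0 <= - t by rewrite oppr_ge0.
apply: (@gronwall_ge0 (fun s => h (- s)) (fun s => - dh (- s)) k) t0.
- move=> s; have dN : is_derive s 1 (-%R : R -> R) (-1) by exact: is_deriveNid.
  by have := is_derive1_comp (dhP (- s)) dN; rewrite mulrN1.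
- by move=> s; apply: le_trans (dhk (- s)); rewrite -normrN ler_norm.
- by rewrite oppr0.
Qed.

End Gronwall.

Section AxisRotation.
Variable R : realType.
Implicit Types (a u v x b : 'rV[R]_3) (t w : R).

Lemma axis_rotation0 a u x : axis_rotation a u 0 x = x.
Proof.
rewrite /axis_rotation cos0 sin0 subrr mul0r !scale0r scale1r !addr0.
by rewrite addrC subrK.
Qed.

Lemma is_derive_axis_rotation a u x t : enorm u = 1 ->
  is_derive t 1 (fun s => axis_rotation a u s x)
    (cross u (axis_rotation a u t x - a)).
Proof.
move=> u1; have uu : dot u u = 1 by apply/sphere_dot.
pose w := x - a.
have -> : axis_rotation a u t x - a
    = cos t *: w + sin t *: cross u w + ((1 - cos t) * dot u w) *: u.
  by rewrite /axis_rotation addrAC subrr add0r.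
have dc := is_derive_scale (is_derive_cos t) (is_derive_cst w t 1).
have ds := is_derive_scale (is_derive_sin t) (is_derive_cst (cross u w) t 1).
have d1 : is_derive t 1 (fun s : R => (1 - cos s) * dot u w) (sin t * dot u w).
  have := is_deriveM (is_deriveB (is_derive_cst (1 : R) t 1) (is_derive_cos t))
    (is_derive_cst (dot u w) t 1).
  by rewrite scaler0 !add0r opprK [_ *: _]mulrC.
have d2 := is_derive_scale d1 (is_derive_cst u t 1).
have := is_deriveD (is_derive_cst a t 1) (is_deriveD (is_deriveD dc ds) d2).
rewrite !scaler0 !add0r; congr (is_derive _ _ _ _).
transitivity (- sin t *: (dot u u *: w) + cos t *: cross u w
   + (sin t * dot u w) *: u); first by rewrite uu scale1r.
move: (sin t) (cos t) => s c; row_ring.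
Qed.

Lemma is_derive_axis_rotation_speed a u x w t : enorm u = 1 ->
  is_derive t 1 (fun s => axis_rotation a u (w * s) x)
    (w *: cross u (axis_rotation a u (w * t) x - a)).
Proof.
move=> u1; have [dr vr] := is_derive_axis_rotation a x (w * t) u1.
have dw : is_derive t 1 (fun s : R => w * s) w.
  by have := is_deriveZ w (is_derive_id t 1); rewrite [_ *: 1]mulr1.
have dr' := (derivable1_diffP _ _).1 dr.
have := is_derive_chain dr' dw; congr (is_derive _ _ _ _).
by rewrite -vr deriveE // -linearZZ [w *: 1]mulr1.
Qed.

(** The left side is the velocity at the point [x + m u] of a screw motion of
    angular speed [w] and translation speed [l] about the line [b + R u]; the
    right side has the shape of the velocity field of a rigid body. *)
Lemma screw_velocity w l m u x b :
  w *: cross u (x - b) + l *: u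
  = (l *: u - w *: cross u b) + cross (w *: u) (x + m *: u).
Proof. row_ring. Qed.

Lemma dot_axis_rotation a u x t : enorm u = 1 ->
  dot u (axis_rotation a u t x - a) = dot u (x - a).
Proof.
move=> /sphere_dot uu; rewrite /axis_rotation; move: (x - a) => w.
rewrite addrAC subrr add0r !dotDr !dotZr dot_crossr uu.
by ring.
Qed.

Lemma axis_rotationK a u x t : enorm u = 1 ->
  axis_rotation a u t (axis_rotation a u (- t) x) = x.
Proof.
move=> u1; have uu : dot u u = 1 by apply/sphere_dot.
rewrite {1}/axis_rotation dot_axis_rotation // -[RHS](subrKC a); congr (a + _).
have sub v : a + v - a = v by rewrite addrAC subrr add0r.
rewrite /axis_rotation cosN sinN !sub; move: (x - a) => w.
have cs := cos2Dsin2 t; move: (cos t) (sin t) cs => c s cs.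
transitivity ((c ^+ 2) *: w + (s ^+ 2) *: (dot u u *: w)
  + (1 - (c ^+ 2 + s ^+ 2)) * dot u w *: u).
  by row_ring.
by rewrite uu scale1r -scalerDl cs subrr mul0r scale0r scale1r addr0.
Qed.

Lemma axis_rotationD C b u t x :
  axis_rotation (C + b) u t (C + x) = C + axis_rotation b u t x.
Proof.
have xb : C + x - (C + b) = x - b by rewrite opprD addrACA subrr add0r.
by rewrite /axis_rotation xb -addrA.
Qed.

End AxisRotation.

(** * Gauge and light fields seen by a camera *)

Section Camera.
Variables (R : realType) (Omega : set 'rV[R]_3) (M : 'rV[R]_3 -> 'rV[R]_3).
Variables (ysigma : 'rV[R]_3 -> R) (C : 'rV[R]_3).
Hypotheses (sc : scene Omega M ysigma) (OC : Omega C).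
Implicit Types (x y v eta : 'rV[R]_3) (t : R).

(** The label of the point of the surface on the ray from [C] through [x], with
    no reference to the orientation of the camera. *)
Definition seen x : 'rV[R]_3 :=
  get [set s | sphere2 R s /\ M s = C + (gauge Omega C x)^-1 *: x].

Definition light x : R := ysigma (seen x).

Local Notation p := (gauge Omega C).

Let oO : open Omega. Proof. by case: sc. Qed.
Let cO : convex_set Omega. Proof. by case: sc. Qed.
Let bO : bounded_set Omega. Proof. by case: sc. Qed.

Let pgt0 x : x != 0 -> 0 < p x. Proof. exact: gauge_gt0. Qed.

Let pZ t x : 0 < t -> p (t *: x) = t * p x. Proof. exact: gaugeZ. Qed.

Let Mbij : set_bij (sphere2 R) (boundary Omega) M.
Proof. by case: sc => _ _ _ _ []. Qed.

Let M_C1 : C1_on (sphere2 R) M. Proof. by case: sc => _ _ _ _ []. Qed.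

Lemma boundaryP x : boundary Omega (C + x) <-> p x = 1.
Proof. exact: gauge_eq1. Qed.

Lemma gauge_surface s : sphere2 R s -> p (M s - C) = 1.
Proof.
move=> s1; apply/boundaryP; rewrite subrKC.
by case: Mbij => Mf _ _; exact: Mf.
Qed.

Lemma gauge_hit x : x != 0 -> p ((p x)^-1 *: x) = 1.
Proof. by move=> x0; rewrite pZ ?invr_gt0 ?pgt0 // mulVf // gt_eqF // pgt0. Qed.

Lemma gauge1_neq0 x : p x = 1 -> x != 0.
Proof.
apply: contra_eq_neq => ->; rewrite gauge0 //; first by rewrite eq_sym oner_eq0.
Qed.

Lemma seenP x : x != 0 -> sphere2 R (seen x) /\ M (seen x) = C + (p x)^-1 *: x.
Proof.
move=> x0; have [_ _ Msurj] := Mbij.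
have [s s1 Ms] := Msurj _ ((boundaryP _).2 (gauge_hit x0)).
by apply: (@getPex _ [set s | sphere2 R s /\ M s = C + (p x)^-1 *: x]); exists s.
Qed.

Lemma seen_eq x s :
  x != 0 -> sphere2 R s -> M s = C + (p x)^-1 *: x -> seen x = s.
Proof.
move=> x0 s1 Ms; have [v1 Mv] := seenP x0; have [_ Minj _] := Mbij.
by apply: Minj; rewrite ?inE // Ms.
Qed.

Lemma seenZ t x : 0 < t -> seen (t *: x) = seen x.
Proof.
move=> t0; rewrite /seen pZ // scalerA invfM mulrAC mulVf ?gt_eqF // mul1r.
by [].
Qed.

(** The positively homogeneous extension of the parametrization, centered at
    [C]: it maps rays to rays and turns the gauge into the Euclidean norm. *)
Definition polar y : 'rV[R]_3 := enorm y *: (M ((enorm y)^-1 *: y) - C).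

Lemma gauge_polar y : y != 0 -> p (polar y) = enorm y.
Proof.
move=> y0; rewrite pZ ?enorm_gt0 // gauge_surface ?mulr1 //.
exact: sphere_normalize.
Qed.

Let near_neq0 x : x != 0 -> \forall y \near x, y != 0.
Proof.
move=> x0.
have o : open [set y : 'rV[R]_3 | y != 0].
  have -> : [set y : 'rV[R]_3 | y != 0] = ~` [set 0].
    by apply/seteqP; split => y /= /eqP.
  apply: closed_openC; apply: accessible_closed_set1.
  apply: hausdorff_accessible; exact: norm_hausdorff.
exact: (open_nbhs_nbhs (conj o x0)).
Qed.

Lemma differentiable_polar y : y != 0 -> differentiable polar y.
Proof.
move=> y0; have dN := differentiable_enorm y0.
have dNV : differentiable (fun z => (enorm z)^-1) y.
  by apply: differentiableV => //; rewrite enorm_eq0.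
apply: differentiable_scale; first exact: dN.
have du : differentiable (fun z : 'rV[R]_3 => (enorm z)^-1 *: z) y.
  by apply: differentiable_scale.
have dM : differentiable (M \o (fun z => (enorm z)^-1 *: z)) y.
  apply: differentiable_C1_on M_C1 du _.
  by apply: filterS (near_neq0 y0) => z; exact: sphere_normalize.
exact: (differentiableB dM (differentiable_cst C y)).
Qed.

(** Let [dpolar_s w = 0] and follow the line [c t = s + t w].  The curve
    [polar (c t)] has zero velocity at 0, so its gauge, which is [|c t|], is
    stationary.  Hence so are the surface point [C + polar (c t) / |c t|], its
    label [c t / |c t|], and finally [c t] itself. *)
Lemma polar_inj s w : sphere2 R s -> 'd polar s w = 0 -> w = 0.
Proof.
move=> s1 dw; have s0 := sphere_neq0 s1.
have [k k0 pk] := gauge_lipschitz oO cO OC.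
have [_ _ [g [gC1 gK]]] := scene_surface sc.
pose c (t : R) := s + t *: w.
have c0 : c 0 = s by rewrite /c scale0r addr0.
have dc : is_derive (0 : R) 1 c w by exact: is_derive_line.
have cne : \forall t \near (0 : R), c t != 0.
  have cc : {for 0, continuous c}.
    by apply/differentiable_continuous/derivable1_diffP; have [] := dc.
  have nc : \forall y \near c 0, y != 0 by rewrite c0; exact: near_neq0.
  exact: cc _ nc.
have dpolar : is_derive (0 : R) 1 (polar \o c) 0.
  have dp0 : differentiable polar (c 0) by rewrite c0; exact: differentiable_polar.
  by have := is_derive_chain dp0 dc; rewrite c0 dw.
have dN : is_derive (0 : R) 1 (fun t => enorm (c t)) 0.
  have := is_derive_lipschitz0 pk dpolar.
  apply: near_eq_is_derive; apply: filterS cne => t ct.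
  by rewrite /= gauge_polar.
have dNV : is_derive (0 : R) 1 (fun t => (enorm (c t))^-1) 0.
  have Nc : enorm (c 0) != 0 by rewrite c0 enorm_eq0.
  have := @is_deriveV R (fun t => enorm (c t)) 0 0 1 Nc dN.
  by rewrite scaler0.
have dhit : is_derive (0 : R) 1 (fun t => C + (enorm (c t))^-1 *: polar (c t)) 0.
  have := is_deriveD (is_derive_cst C (0 : R) 1) (is_derive_scale dNV dpolar).
  by rewrite scaler0 scale0r !addr0.
have hitE t : c t != 0 ->
    C + (enorm (c t))^-1 *: polar (c t) = M ((enorm (c t))^-1 *: c t).
  by move=> ct; rewrite /polar scalerK ?enorm_eq0 // subrKC.
have dg : is_derive (0 : R) 1 (g \o (fun t => C + (enorm (c t))^-1 *: polar (c t))) 0.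
  apply: is_derive_C1_on0 gC1 dhit _; apply: filterS cne => t ct.
  rewrite hitE //; case: Mbij => Mf _ _; apply: Mf; exact: sphere_normalize.
have dcc : is_derive (0 : R) 1 c 0.
  have := is_derive_scale dN dg; rewrite scaler0 scale0r addr0.
  apply: near_eq_is_derive; apply: filterS cne => t ct.
  rewrite /= hitE // gK ?inE; last exact: sphere_normalize.
  by rewrite scalerKV // enorm_eq0.
by have [_ <-] := dc; have [_ ->] := dcc.
Qed.

Lemma differentiable_gauge x : x != 0 -> differentiable p x.
Proof.
have d1 z : p z = 1 -> differentiable p z.
  move=> pz; have z0 := gauge1_neq0 pz; have [s1 Ms] := seenP z0.
  have s0 := sphere_neq0 s1; have [k k0 pk] := gauge_lipschitz oO cO OC.
  have zE : polar (seen z) = z.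
    by rewrite /polar s1 invr1 !scale1r Ms pz invr1 scale1r addrAC subrr add0r.
  rewrite -zE; apply: (@differentiable_of_lift R 3 p (@enorm R) polar k) => //.
  - exact: differentiable_polar.
  - exact: differentiable_enorm.
  - by apply: filterS (near_neq0 s0) => y; exact: gauge_polar.
  - by move=> w; exact: polar_inj.
move=> x0; have px := pgt0 x0.
have -> : p = p x *: (p \o ( *:%R (p x)^-1)).
  apply/funext => y; rewrite !fctE /= pZ ?invr_gt0 //.
  by rewrite [_ *: _]mulVKf // gt_eqF.
apply: differentiableZ; apply: differentiable_comp; first exact: ex_diff.
exact/d1/gauge_hit.
Qed.

(** The label seen along [y] is the value of the C^1 inverse of [M] at the
    surface point [C + y / p y], which depends differentiably on [y]. *)
Lemma differentiable_light x : x != 0 -> differentiable light x.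
Proof.
move=> x0; have [_ _ [g [gC1 gK]]] := scene_surface sc.
pose hit y := C + (p y)^-1 *: y.
have dhit : differentiable hit x.
  have dV : differentiable (fun y => (p y)^-1) x.
    by apply: differentiableV; [exact: differentiable_gauge | rewrite gt_eqF ?pgt0].
  have di : differentiable (@id 'rV[R]_3) x by [].
  exact: (differentiableD (differentiable_cst C x) (differentiable_scale dV di)).
have seenE y : y != 0 -> g (hit y) = seen y.
  by move=> y0; have [v1 Mv] := seenP y0; rewrite /hit -Mv gK // inE.
have dg : differentiable (g \o hit) x.
  apply: differentiable_C1_on gC1 dhit _; apply: filterS (near_neq0 x0) => y y0.
  exact/boundaryP/gauge_hit.
have := differentiable_C1_on (scene_light sc) dg _.
have gs : \forall y \near x, sphere2 R ((g \o hit) y).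
  by apply: filterS (near_neq0 x0) => y y0; rewrite /= seenE //; have [] := seenP y0.
move=> /(_ gs)/differentiableP dl.
apply: (ex_diff (is_diff_def := near_eq_is_diff _ dl)).
by apply: filterS (near_neq0 x0) => y y0; rewrite /= seenE.
Qed.

Let p_ge0 x : 0 <= p x. Proof. exact: gauge_ge0. Qed.

Local Notation L := light.

Let LZ t x : 0 < t -> L (t *: x) = L x.
Proof. by move=> t0; rewrite /light seenZ. Qed.

Let dp x : x != 0 -> differentiable p x.
Proof. exact: (differentiable_gauge). Qed.
Let dL x : x != 0 -> differentiable L x.
Proof. exact: (differentiable_light). Qed.

Let scale_neq0 t x : 0 < t -> x != 0 -> t *: x != 0.
Proof. by move=> t0 x0; rewrite scaler_eq0 negb_or gt_eqF. Qed.

Lemma diff_gaugeZ t x v : 0 < t -> x != 0 -> 'd p (t *: x) v = 'd p x v.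
Proof.
move=> t0 x0; apply: diff_homogeneous1 => [|y||].
- by rewrite gt_eqF.
- exact: pZ.
- exact: dp.
- exact/dp/scale_neq0.
Qed.

Lemma diff_lightZ t x v : 0 < t -> x != 0 -> 'd L (t *: x) (t *: v) = 'd L x v.
Proof.
by move=> t0 x0; apply: diff_homogeneous0 => [y|]; [exact: LZ | exact/dL/scale_neq0].
Qed.

Lemma diff_gauge_self x : x != 0 -> 'd p x x = p x.
Proof.
by move=> x0; apply: euler_homogeneous1 => [t t0|]; [exact: pZ | exact: dp].
Qed.

Lemma diff_light_self x : x != 0 -> 'd L x x = 0.
Proof.
by move=> x0; apply: euler_homogeneous0 => [t t0|]; [exact: LZ | exact: dL].
Qed.

(** Rotating the viewing direction into the reference frame reduces the
    orientation of the camera to the identity. *)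
Lemma label_seenE q eta : unit_quat q -> sphere2 R eta ->
  label_seen M C q eta = seen (qrot q eta).
Proof.
move=> uq e1; have z1 := sphere_qrot uq e1; have z0 := sphere_neq0 z1.
set zeta := qrot q eta in z1 z0 *.
congr get; apply/seteqP; split=> s /= [s1]; rewrite /view_quat qmul_conj.
  move=> [eE]; split=> //; have m1 := gauge_surface s1.
  have m0 := gauge1_neq0 m1; set m := M s - C in m1 m0 eE.
  have zE : zeta = (enorm m)^-1 *: m by rewrite /zeta eE qrotVK.
  have mE : enorm m != 0 by rewrite enorm_eq0.
  (* The gauge of [m] is 1, so that of the unit vector along [m] is [1 / |m|]. *)
  have -> : (p zeta)^-1 = enorm m.
    by rewrite zE pZ ?invr_gt0 ?enorm_gt0 // m1 mulr1 invrK.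
  by rewrite zE scalerKV // /m subrKC.
move=> Ms; split=> //; congr imq; rewrite Ms addrAC subrr add0r.
have pz := pgt0 z0; rewrite enormZ ?invr_ge0 ?ltW // z1 mulr1 invrK.
by rewrite scalerA divff ?gt_eqF // scale1r qrotK.
Qed.

Lemma depthE q eta : unit_quat q -> sphere2 R eta ->
  depth M C q eta = (p (qrot q eta))^-1.
Proof.
move=> uq e1; have z1 := sphere_qrot uq e1; have z0 := sphere_neq0 z1.
rewrite /depth label_seenE //; have [_ ->] := seenP z0.
rewrite addrAC subrr add0r enormZ ?z1 ?mulr1 //.
by rewrite invr_ge0 ltW // pgt0.
Qed.

Lemma brightnessE q eta : unit_quat q -> sphere2 R eta ->
  brightness M ysigma C q eta = L (qrot q eta).
Proof. by move=> uq e1; rewrite /brightness label_seenE. Qed.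

Lemma is_diff_qrot q x : is_diff x (qrot q) (qrot q).
Proof.
have lin : linear (qrot q) by move=> k u v; rewrite qrotD qrotZ.
pose lM := GRing.isLinear.Build _ _ _ _ _ lin.
pose rot : {linear 'rV[R]_3 -> 'rV[R]_3} := HB.pack (qrot q) lM.
have rotE : qrot q = fun y => y *m lin1_mx rot.
  by apply/funext => y; rewrite mul_rV_lin1.
have rc y : differentiable rot y.
  by rewrite -[rot : _ -> _]/(qrot q) rotE; exact: differentiable_mulmx.
have rotc : continuous rot by move=> y; exact/differentiable_continuous/rc.
by apply: DiffDef; [exact: rc | exact: (diff_lin x rotc)].
Qed.

Section Equations.
Variables (q : quat R) (pv pw : 'rV[R]_3).
Hypothesis uq : unit_quat q.

(** The velocity field of the motion, in the reference frame translated to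
    [C]. *)
Definition velocity x : 'rV[R]_3 := qrot q pv + cross (qrot q pw) x.

Variables eta zeta x a : 'rV[R]_3.
Hypotheses (e1 : sphere2 R eta) (zE : qrot q eta = zeta).
Hypothesis xE : x = (p zeta)^-1 *: zeta.
Hypothesis aE : a = cross eta (pw + (depth M C q eta)^-1 *: cross eta pv).

Let z1 : sphere2 R zeta. Proof. by rewrite -zE; exact: sphere_qrot. Qed.
Let z0 : zeta != 0. Proof. exact: sphere_neq0. Qed.
Let pz : 0 < p zeta. Proof. exact: pgt0. Qed.
Let x0 : x != 0. Proof. by rewrite xE; apply: scale_neq0; rewrite ?invr_gt0. Qed.
Let zx : zeta = p zeta *: x.
Proof. by rewrite xE scalerA divff ?gt_eqF // scale1r. Qed.
Let eta_a : dot eta a = 0. Proof. by rewrite aE; exact: dot_crossr. Qed.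

(** The vector [a] is the velocity of the viewing direction.  In the reference
    frame it is [- p zeta] times the part of [velocity x] orthogonal to [zeta]:
    the vector [cross W x] being orthogonal to [x], the radial part of
    [velocity x] is [dot zeta P]. *)
Let rot_a : qrot q a
  = (p zeta * dot zeta (qrot q pv)) *: zeta - p zeta *: velocity x.
Proof.
rewrite aE depthE // invrK -cross_qrot // qrotD qrotZ -cross_qrot // zE.
rewrite cross_add_cross ((sphere_dot _).1 z1) mulr1 -addrA -opprD; congr (_ - _).
rewrite /velocity [RHS]scalerDr; congr (_ + _).
by rewrite -crossZr -zx.
Qed.

(** The depth is [1 / p] along the unit directions.  In its differential, the
    radial term of [rot_a] contributes [- dot zeta P] by Euler's relation; this
    cancels the second term of the left side. *)
Lemma depth_equation :
  dot (sphere_grad (depth M C q) eta) a + dot eta pv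
  = (p zeta)^-1 * 'd p x (velocity x).
Proof.
have dq := is_diff_qrot q eta.
have dpz : differentiable p (qrot q eta) by rewrite zE; exact: dp.
have dpq : differentiable (p \o qrot q) eta.
  by apply: differentiable_comp; first exact: ex_diff.
have pn : (p \o qrot q) eta != 0 by rewrite /= zE gt_eqF.
have e0 : dot (sphere_grad (depth M C q) eta) a
    = 'd (fun y => ((p \o qrot q) y)^-1) eta a.
  apply: dot_sphere_grad => //; first by move=> y y1; rewrite depthE.
  exact: differentiableV.
have e2 : 'd (fun y => ((p \o qrot q) y)^-1) eta a
    = - (p zeta) ^- 2 * 'd (p \o qrot q) eta a.
  by rewrite -zE; exact: (congr1 (@^~ a) (diffV dpq pn)).
have e3 : 'd (p \o qrot q) eta a = 'd p zeta (qrot q a).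
  by rewrite -zE; exact: (diff_chain a dq dpz).
have ex : 'd p x (velocity x) = 'd p zeta (velocity x).
  have t0 : 0 < (p zeta)^-1 by rewrite invr_gt0.
  by have := diff_gaugeZ (velocity x) t0 z0; rewrite -xE.
have e4 : 'd p zeta (qrot q a)
    = p zeta * dot zeta (qrot q pv) * p zeta - p zeta * 'd p zeta (velocity x).
  have c := linear_combB ('d p zeta) (p zeta * dot zeta (qrot q pv)) (p zeta)
    zeta (velocity x).
  rewrite rot_a; apply: (etrans c); congr (_ * _ - _).
  exact: diff_gauge_self.
have e5 : dot zeta (qrot q pv) = dot eta pv by rewrite -zE dot_qrot.
have tot := etrans e0 (etrans e2 (congr1 ( *%R _) (etrans e3 e4))).
apply: (etrans _ (congr1 ( *%R _) (esym ex))); rewrite tot e5.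
move: (p zeta) pz (dot eta pv) ('d p zeta _) => k k0 m n; field.
by rewrite gt_eqF.
Qed.

Lemma brightness_equation :
  dot (sphere_grad (brightness M ysigma C q) eta) a = - 'd L x (velocity x).
Proof.
have dq := is_diff_qrot q eta.
have dLz : differentiable L (qrot q eta) by rewrite zE; exact: dL.
have e0 : dot (sphere_grad (brightness M ysigma C q) eta) a
    = 'd (L \o qrot q) eta a.
  apply: dot_sphere_grad => //; first by move=> y y1; rewrite brightnessE.
  by apply: differentiable_comp; first exact: ex_diff.
have e3 : 'd (L \o qrot q) eta a = 'd L zeta (qrot q a).
  by rewrite -zE; exact: (diff_chain a dq dLz).
have e5 : p zeta * 'd L zeta (velocity x) = 'd L x (velocity x).
  apply: (etrans _ (diff_lightZ _ pz x0)); rewrite -zx.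
  by apply/esym; exact: linearZZ.
have c := linear_combB ('d L zeta) (p zeta * dot zeta (qrot q pv)) (p zeta)
  zeta (velocity x).
apply: (etrans e0); apply: (etrans e3); rewrite rot_a; apply: (etrans c).
transitivity (p zeta * dot zeta (qrot q pv) * 0 - 'd L x (velocity x)).
  by congr (_ * _ - _); [exact: diff_light_self | exact: e5].
by rewrite mulr0 sub0r.
Qed.

End Equations.

Lemma stationaryP q pv pw : unit_quat q ->
  (let y := brightness M ysigma C q in let D := depth M C q in
   forall eta, sphere2 R eta ->
     dot (sphere_grad D eta) (cross eta (pw + (D eta)^-1 *: cross eta pv))
       + dot eta pv = 0 /\
     dot (sphere_grad y eta) (cross eta (pw + (D eta)^-1 *: cross eta pv)) = 0)
  <-> (forall x, p x = 1 ->
         'd p x (velocity q pv pw x) = 0 /\ 'd L x (velocity q pv pw x) = 0).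
Proof.
move=> uq; split=> /= [h x px|h eta e1].
  have x0 := gauge1_neq0 px; have N0 : 0 < enorm x by rewrite enorm_gt0.
  (* The viewing direction of the surface point [x]. *)
  pose eta := qrot (qconj q) ((enorm x)^-1 *: x).
  have e1 : sphere2 R eta.
    by apply: sphere_qrot; [exact: unit_qconj | exact: sphere_normalize].
  have zE : qrot q eta = (enorm x)^-1 *: x by rewrite qrotVK.
  have pz : p (qrot q eta) = (enorm x)^-1 by rewrite zE pZ ?invr_gt0 // px mulr1.
  have xE : (p (qrot q eta))^-1 *: qrot q eta = x.
    by rewrite pz zE scalerA mulVf ?scale1r // invr_eq0 gt_eqF.
  have [h1 h2] := h eta e1.
  have de := depth_equation (pv := pv) (pw := pw) uq e1 erefl (esym xE) (erefl (cross eta _)).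
  have be := brightness_equation (pv := pv) (pw := pw) uq e1 erefl (esym xE) (erefl (cross eta _)).
  split; last by apply: oppr_inj; rewrite oppr0; apply: (etrans (esym be)).
  have /eqP := etrans (esym de) h1.
  by rewrite mulf_eq0 invr_eq0 pz invr_eq0 gt_eqF //= => /eqP.
have z0 := sphere_neq0 (sphere_qrot uq e1).
have [h1 h2] := h _ (gauge_hit z0).
split.
  apply: (etrans (depth_equation uq e1 erefl erefl (erefl (cross eta _)))).
  by apply: (etrans (congr1 ( *%R _) h1)); rewrite mulr0.
apply: (etrans (brightness_equation uq e1 erefl erefl (erefl (cross eta _)))).
by apply: (etrans (congr1 -%R h2)); rewrite oppr0.
Qed.

Section Flow.
Variables (P W : 'rV[R]_3).
Let V x : 'rV[R]_3 := P + cross W x.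
Hypothesis tangent : forall x, p x = 1 -> 'd p x (V x) = 0 /\ 'd L x (V x) = 0.

(** Write [V x] as [(1 - p x) P + p x V (x / p x)]: the second vector is tangent
    at the surface point [x / p x], where the differential of [p] is the same as
    at [x]. *)
Let diff_gauge_field x : x != 0 -> 'd p x (V x) = (1 - p x) * 'd p x P.
Proof.
move=> x0; have px := pgt0 x0; have pVx : 0 < (p x)^-1 by rewrite invr_gt0.
have hx := gauge_hit x0.
have VE : V x = (1 - p x) *: P - (- p x) *: V ((p x)^-1 *: x).
  have : p x != 0 by rewrite gt_eqF.
  rewrite /V crossZr; move: (p x) => r r0.
  rewrite scaleNr opprK scalerDr scalerA divff // scale1r.
  by rewrite addrA -scalerDl subrK scale1r.
rewrite VE; apply: (etrans (linear_combB _ _ _ _ _)).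
have e := diff_gaugeZ (V ((p x)^-1 *: x)) pVx x0.
have [e0 _] := tangent hx; have {e e0}e := etrans (esym e) e0.
by rewrite e mulr0 subr0.
Qed.

Let speed_bound : exists2 k, 0 <= k & forall x, x != 0 -> `|'d p x P| <= k.
Proof.
have [k k0 pk] := gauge_lipschitz oO cO OC.
exists (k * `|P|) => [|x x0]; first by rewrite mulr_ge0 // ltW.
have dl := is_derive_line x P 0.
have dp0 : differentiable p (x + 0 *: P) by rewrite scale0r addr0; exact: dp.
have := is_derive_chain dp0 dl; rewrite scale0r addr0.
apply: is_derive_bound => s; apply: (le_trans (pk _ _)).
rewrite scale0r addr0 addrAC subrr add0r normrZ subr0.
by rewrite mulrAC mulrA.
Qed.

(** The gauge is not differentiable at the origin, but its square is.  This
    lets the orbits be followed before it is known that they avoid the origin. *)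
Let is_diff_gauge_sqr0 : is_diff 0 (p * p) (0 : 'rV[R]_3 -> R).
Proof.
have [k k0 pk] := gauge_upper oO cO OC.
apply: is_diff_small => e e0.
have r0 : 0 < e / (k * k) by rewrite divr_gt0 // mulr_gt0.
have := nbhsx_ballx (0 : 'rV[R]_3) _ r0; apply: filterS => y.
rewrite -ball_normE /= sub0r normrN ltr_pdivlMr ?mulr_gt0 // => /ltW yr.
rewrite !fctE ger0_norm ?mulr_ge0 // subr0.
apply: (le_trans (ler_pM _ _ (pk y) (pk y))) => //.
rewrite mulrACA mulrA ler_wpM2r // mulrC.
by [].
Qed.

Variable X : R -> 'rV[R]_3.
Hypotheses (dX : forall t : R, is_derive t 1 X (V (X t))) (pX0 : p (X 0) = 1).

(** Gronwall's inequality for [(p ^ 2 - 1) ^ 2].  Its derivative along the flow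
    is at most [2 |p ^ 2 - 1| (2 k p |p - 1|)], where [k] bounds [dp P], and
    [p |p - 1| <= |p ^ 2 - 1|]. *)
Lemma flow_gauge t : p (X t) = 1.
Proof.
have [k k0 hk] := speed_bound.
pose Q s := p (X s) * p (X s).
have /choice[d dQ] : forall s : R, exists d, is_derive s 1 Q d /\
    `|d| <= 2 * k * (p (X s) * `|p (X s) - 1|).
  move=> s; have [X0|X0] := eqVneq (X s) 0.
    exists 0; split; last by rewrite normr0 !mulr_ge0.
    have [d0 d0E] := is_diff_gauge_sqr0.
    rewrite -X0 in d0 d0E.
    have := is_derive_chain d0 (dX s).
    by rewrite d0E.
  have dpX := is_derive_chain (dp X0) (dX s).
  set e := 'd p (X s) (V (X s)) in dpX.
  exists (p (X s) * e + p (X s) * e); split; first exact: (is_deriveM dpX dpX).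
  rewrite -mulrDr normrM ger0_norm // -mulr2n normrMn.
  rewrite (_ : e = (1 - p (X s)) * 'd p (X s) P); last exact: diff_gauge_field.
  rewrite normrM distrC.
  rewrite [leRHS](_ : _ = p (X s) * (2 * (`|p (X s) - 1| * k))); last by ring.
  apply: ler_wpM2l; first exact: p_ge0.
  by rewrite -[leLHS]mulr_natl; apply: ler_wpM2l => //; apply: ler_wpM2l => //; exact: hk.
pose h s := (Q s - 1) * (Q s - 1).
pose dh s := (Q s - 1) * d s + (Q s - 1) * d s.
have hP (s : R) : is_derive s 1 h (dh s).
  have [dQs _] := dQ s.
  have := is_deriveB dQs (is_derive_cst (1 : R) s 1); rewrite subr0 => d1.
  exact: (is_deriveM d1 d1).
have dhk s : `|dh s| <= (4 * k) * h s.
  have [_ ds] := dQ s; move: ds; rewrite /dh /h /Q -mulrDr normrM -mulr2n normrMn.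
  move: (p (X s)) (p_ge0 (X s)) (d s) => r r0 e.
  have -> : r * r - 1 = (r - 1) * (r + 1) by ring.
  have r1 : 0 <= r + 1 by rewrite addr_ge0.
  rewrite normrM [`|r + 1|]ger0_norm // => ek.
  rewrite -[`|e| *+ 2]mulr_natl.
  apply: (@le_trans _ _ (`|r - 1| * (r + 1) * (2 * (2 * k * (r * `|r - 1|))))).
    by rewrite ler_wpM2l ?mulr_ge0 // ler_wpM2l.
  have -> : `|r - 1| * (r + 1) * (2 * (2 * k * (r * `|r - 1|)))
      = 4 * k * (`|r - 1| ^+ 2 * (r + 1)) * r by ring.
  have -> : 4 * k * ((r - 1) * (r + 1) * ((r - 1) * (r + 1)))
      = 4 * k * (`|r - 1| ^+ 2 * (r + 1)) * (r + 1) by rewrite real_normK ?num_real //; ring.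
  rewrite ler_wpM2l // ?lerDl // !mulr_ge0 // exprn_ge0 //.
have h0 : h 0 = 0 by rewrite /h /Q pX0 mulr1 subrr mul0r.
have h_ge0 s : 0 <= h s by rewrite /h -expr2 sqr_ge0.
have := gronwall_eq0 hP dhk h_ge0 h0 t.
move/eqP; rewrite mulf_eq0 orbb subr_eq0 /Q -expr2 sqrf_eq1 => /orP[/eqP//|/eqP e].
by have := p_ge0 (X t); rewrite e oppr_ge0 ler10.
Qed.

Lemma flow_light t : L (X t) = L (X 0).
Proof.
apply: (@is_derive_0_is_cst R (L \o X)) => s.
have ps := flow_gauge s; have X0 := gauge1_neq0 ps.
have := is_derive_chain (differentiable_light X0) (dX s).
by have [_ ->] := tangent ps.
Qed.

End Flow.

Let lightE s x : sphere2 R s -> M s = C + x -> L x = ysigma s.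
Proof.
move=> s1 Ms; have := gauge_surface s1.
rewrite Ms addrAC subrr add0r => px; congr ysigma.
apply: (seen_eq _ s1); first exact: (gauge1_neq0 px).
by rewrite px invr1 scale1r.
Qed.

(** The surface is bounded, so no nonzero vector can be added to one of its
    points indefinitely. *)
Lemma gauge_translate_eq0 x v :
  (forall n, p (x + v *+ n) = 1) -> v = 0.
Proof.
move=> pv; have [k k0 hk] := gauge_lower (scene_open sc) (scene_convex sc) OC bO.
apply/eqP; rewrite -normr_eq0; apply/negPn/negP => v0.
have {}v0 : 0 < `|v| by rewrite lt_def v0 normr_ge0.
have [n hn] : exists n : nat, (k + `|x|) / `|v| < n%:R.
  by exists (Num.truncn ((k + `|x|) / `|v|)).+1; exact: truncnS_gt.
have := hk (x + v *+ n); rewrite pv mulr1 leNgt => /negP; apply.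
move: hn; rewrite ltr_pdivrMr // -ltrBrDr => /lt_le_trans; apply.
by rewrite mulr_natl -normrMn [x + _]addrC lerB_normD.
Qed.

(** The rotations carry [x] along a curve on which [p] and [L] are constant;
    its initial velocity is the field of the statement. *)
Lemma tangent_of_axis a u : enorm u = 1 ->
  (forall theta, axis_rotation a u theta @` boundary Omega = boundary Omega /\
     forall s s', sphere2 R s -> sphere2 R s' ->
       M s' = axis_rotation a u theta (M s) -> ysigma s' = ysigma s) ->
  forall x, p x = 1 ->
    'd p x (cross u (C - a) + cross u x) = 0 /\
    'd L x (cross u (C - a) + cross u x) = 0.
Proof.
move=> u1 inv x px; have x0 := gauge1_neq0 px.
pose X (t : R) := axis_rotation a u t (C + x) - C.
have X0 : X 0 = x by rewrite /X axis_rotation0 addrAC subrr add0r.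
have dX : is_derive (0 : R) 1 X (cross u (C - a) + cross u x).
  have := is_deriveB (is_derive_axis_rotation a (C + x) 0 u1) (is_derive_cst C (0 : R) 1).
  rewrite subr0 axis_rotation0; congr (is_derive _ _ _ _).
  by rewrite -crossDr; congr (cross u _); exact: addrAC.
have pX t : p (X t) = 1.
  apply/boundaryP; rewrite subrKC; have [<- _] := inv t.
  by exists (C + x) => //; apply/boundaryP.
have LX t : L (X t) = L x.
  have [s1 Ms] := seenP x0; rewrite px invr1 scale1r in Ms.
  have [t1 Mt] := seenP (gauge1_neq0 (pX t)).
  rewrite pX invr1 scale1r in Mt.
  rewrite (lightE s1 Ms) (lightE t1 Mt).
  have [_ h] := inv t; apply: h => //.
  by rewrite Mt Ms subrKC.
have dpx := dp x0; have dLx := dL x0; rewrite -X0 in dpx dLx.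
have := is_derive_chain dpx dX; have := is_derive_chain dLx dX.
rewrite X0.
have -> : L \o X = cst (L x) by apply/funext => t; exact: LX.
have -> : p \o X = cst 1 by apply/funext => t; exact: pX.
move=> [_ eL] [_ ep].
by split; [apply: (etrans (esym ep)) | apply: (etrans (esym eL))]; exact: derive_cst.
Qed.

(** A motion with [W = 0] moves the points along lines, which leave a bounded
    surface.  Otherwise the flow is a screw motion, which after a full turn is a
    translation along the axis; this translation preserves the surface, so it
    is trivial and the flow consists of rotations. *)
Lemma axis_of_tangent P W : (P, W) <> (0, 0) ->
  (forall x, p x = 1 ->
    'd p x (P + cross W x) = 0 /\ 'd L x (P + cross W x) = 0) ->
  has_rotation_axis Omega M ysigma.
Proof.
move=> PW0 tg.
have [x0 px0] : exists x, p x = 1.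
  have e1 : sphere2 R (delta_mx 0 0).
    by apply/sphere_dot; rewrite dotE !mxE /=; ring.
  by have := gauge_surface e1; exists (M (delta_mx 0 0) - C).
have W0 : W != 0.
  apply/eqP => W0; rewrite W0 in tg PW0.
  apply: PW0; congr pair; apply: (@gauge_translate_eq0 x0) => n.
  have dX (t : R) : is_derive t 1 (fun s : R => x0 + s *: P)
      (P + cross 0 (x0 + t *: P)).
    have -> : cross 0 (x0 + t *: P) = 0 by row_ring.
    by rewrite addr0; exact: is_derive_line.
  have pX0 : p (x0 + 0 *: P) = 1 by rewrite scale0r addr0.
  by have := flow_gauge tg dX pX0 n%:R; rewrite scaler_nat.
pose w := enorm W; have w0 : 0 < w by rewrite enorm_gt0.
pose u := w^-1 *: W; have u1 : enorm u = 1 by exact: sphere_normalize.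
have uu : dot u u = 1 by apply/sphere_dot.
have Wu : W = w *: u by rewrite /u scalerKV // gt_eqF.
(* The field at [b] is [l u], parallel to [W]: the screw has axis [b + R u] and
   translation speed [l]. *)
pose l := dot u P; pose b := w^-1 *: cross u P.
have PE : P = l *: u - w *: cross u b.
  rewrite /b crossZr scalerA divff ?gt_eqF // scale1r /l cross_cross uu scale1r.
  by rewrite opprB addrC subrK.
pose X x (t : R) := axis_rotation b u (w * t) x + (l * t) *: u.
have dX x t : is_derive t 1 (X x) (P + cross W (X x t)).
  have dl : is_derive t 1 (fun s : R => l * s) l.
    by have := is_deriveZ l (is_derive_id t 1); rewrite [_ *: 1]mulr1.
  have := is_deriveD (is_derive_axis_rotation_speed b x w t u1)
    (is_derive_scale dl (is_derive_cst u t 1)).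
  congr (is_derive _ _ _ _).
  by rewrite PE Wu -screw_velocity scaler0 add0r.
have X0 x : X x 0 = x by rewrite /X !mulr0 axis_rotation0 scale0r addr0.
have l0 : l = 0.
  (* The duration of a full turn. *)
  pose T := (pi *+ 2) / w.
  have XT x : X x T = x + (l * T) *: u.
    rewrite /X /T mulrCA divff ?gt_eqF // mulr1 /axis_rotation cos2pi sin2pi.
    by rewrite subrr mul0r !scale0r scale1r !addr0 subrKC.
  have : (l * T) *: u = 0.
    apply: (@gauge_translate_eq0 x0); elim=> [|n IHn]; first by rewrite addr0.
    rewrite mulrSr addrA -XT.
    by apply: (flow_gauge tg (dX _)); rewrite X0.
  move/eqP; rewrite scaler_eq0 mulf_eq0 => /orP[/orP[/eqP//|]|].
    by rewrite gt_eqF // divr_gt0 // mulrn_wgt0 // pi_gt0.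
  by rewrite -enorm_eq0 u1 oner_eq0.
have XE x t : X x t = axis_rotation b u (w * t) x.
  by rewrite /X l0 mul0r scale0r addr0.
have inv theta x : p x = 1 ->
    p (axis_rotation b u theta x) = 1 /\ L (axis_rotation b u theta x) = L x.
  move=> px; have -> : theta = w * (theta / w) by rewrite mulrCA divff ?mulr1 ?gt_eqF.
  rewrite -XE; have px' : p (X x 0) = 1 by rewrite X0.
  split; first exact: (flow_gauge tg (dX x) px').
  by rewrite (flow_light tg (dX x) px') X0.
have bd theta y : boundary Omega y -> boundary Omega (axis_rotation (C + b) u theta y).
  rewrite -{1 2}[y](subrKC C) => /boundaryP py.
  by rewrite axis_rotationD; apply/boundaryP; have [] := inv theta _ py.
exists (C + b), u; split=> // theta; split.
  apply/seteqP; split=> [_ [y By <-]|y By]; first exact: bd.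
  by exists (axis_rotation (C + b) u (- theta) y); [exact: bd | exact: axis_rotationK].
move=> s s' s1 s1' Ms.
have ps := gauge_surface s1; have [_ Lrot] := inv theta _ ps.
have Lx : L (M s - C) = ysigma s by apply: lightE => //; rewrite subrKC.
rewrite -Lx -Lrot; apply/esym/lightE => //.
by rewrite Ms -axis_rotationD subrKC.
Qed.

End Camera.

Theorem theorem3p1 (R : realType) (Omega : set 'rV[R]_3)
    (M : 'rV[R]_3 -> 'rV[R]_3) (ysigma : 'rV[R]_3 -> R) :
  scene Omega M ysigma ->
  ((exists pv pw : 'rV[R]_3,
      (pv, pw) <> (0%R, 0%R) /\ stationary_motion Omega M ysigma pv pw) <->
   has_rotation_axis Omega M ysigma).
Proof.
move=> sc; split=> [[pv [pw [pv0 [C [q [OC uq st]]]]]]|[a [u [u1 inv]]]].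
  apply: (axis_of_tangent sc OC _ ((stationaryP sc OC pv pw uq).1 st)) => -[P0 W0].
  have q0 : qrot (qconj q) 0 = 0 by rewrite -(scale0r 0) qrotZ !scale0r.
  apply: pv0; congr pair; [rewrite -(qrotK pv uq) P0 | rewrite -(qrotK pw uq) W0];
    exact: q0.
have [C OC] := scene_nonempty sc.
exists (cross u (C - a)), u; split=> [[_ u0]|].
  by have := sphere_neq0 u1; rewrite u0 eqxx.
have uq : unit_quat ((1, 0) : quat R).
  by rewrite /unit_quat /= expr1n (_ : dot 0 0 = 0) ?addr0 //; apply/eqP; rewrite dot_eq0.
exists C, (1, 0); split=> //; apply/(stationaryP sc OC _ _ uq) => x px.
rewrite /velocity !qrot1; exact: (tangent_of_axis sc OC u1 inv px).
Qed.
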